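(* For odd $n\ge 3$, the quotient map $\mathrm{SL}_n(\mathbb Z)\twoheadrightarrow\mathrm{PSL}_n(\mathbb Z)$ is an isomorphism, so $\mathrm{PSL}_n(\mathbb Z)$ has the presentation $\langle a,b\mid\mathcal R_n(a,b)\rangle$. For even $n\ge 4$, one has $$\mathrm{PSL}_n(\mathbb Z)\cong\left\langle a,b\ \middle|\ \mathcal R_n(a,b),\ a^n=1\right\rangle.$$
   Context: $\mathrm{PSL}_n(\mathbb Z)$ is the quotient of $\mathrm{SL}_n(\mathbb Z)$ by its centre. $E_{i,j}$ is the standard $n\times n$ matrix unit, $[x,y]=x^{-1}y^{-1}xy$, and a relation $U=V$ means the relator $UV^{-1}$. Put $\varepsilon_n=(-1)^{n-1}$ and $$a_n=\sum_{i=1}^{n-1}E_{i,i+1}+\varepsilon_nE_{n,1},\qquad b_n=I_n+E_{2,1};$$ the generators $a,b$ correspond to (the images of) $a_n,b_n$. The words $\tau_{ij}=\tau_{i,j}=\tau_{ij}(a,b)$ in the free group on $a,b$ ($1\le i\ne j\le n$) are defined as follows. Step 1: $\tau_{r+1,r}:=a^{-(r-1)}ba^{r-1}$ for $1\le r\le n-1$, and $\tau_{1n}:=\bigl(a^{-(n-1)}ba^{n-1}\bigr)^{\varepsilon_n}$. Step 2: for $d=2,\dots,n-1$ successively and all $i,j$ with $i-j=d$, $\tau_{ij}:=[\tau_{i,j+1},\tau_{j+1,j}]$. Step 3: for $2\le i\le n-1$, $\tau_{in}:=[\tau_{i1},\tau_{1n}]$. Step 4: for $1\le i<j\le n-1$,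 $\tau_{ij}:=[\tau_{in},\tau_{nj}]$. $\mathcal R_n(a,b)$ denotes the following set of relations (indices in $\{1,\dots,n\}$): (1) $[\tau_{i,j},\tau_{k,l}]=1$ for all $i\neq j$, $k\ne l$ with $(i,j)\ne(k,l)$, $i\ne l$, $j\ne k$; (2) $[\tau_{i,j},\tau_{j,k}]=\tau_{i,k}$ for distinct $i,j,k$; (3) $(\tau_{1,2}\tau_{2,1}^{-1}\tau_{1,2})^4=1$; (4) $a=(\tau_{n-1,n}\tau_{n,n-1}^{-1}\tau_{n-1,n})(\tau_{n-2,n-1}\tau_{n-1,n-2}^{-1}\tau_{n-2,n-1})\cdots(\tau_{1,2}\tau_{2,1}^{-1}\tau_{1,2})$. *)

(* Defs.v *)
From HB Require Import structures.
From mathcomp Require Import all_boot all_order all_algebra.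
From mathcomp Require Import boolp classical_sets.

Set Implicit Arguments.
Unset Strict Implicit.
Unset Printing Implicit Defensive.

Import GRing.Theory.

Local Open Scope classical_set_scope.
Local Open Scope group_scope.

Definition group_isomorphism (G H : groupType) (f : G -> H) : Prop :=
  {morph f : x y / x * y} /\ bijective f.

Definition is_normal_subgroup (G : groupType) (N : set G) : Prop :=
  [/\ N 1,
      forall x y, N x -> N y -> N (x / y)
    & forall x g, N x -> N (x ^ g)].

Record normal_subgroup (G : groupType) := NormalSubgroup {
  normal_set :> G -> Prop;
  normal_setP : is_normal_subgroup normal_set
}.

Section Quotient.
Variables (G : groupType) (N : normal_subgroup G).
Implicit Types x y g : G.

Let N1 : N 1. Proof. by case: (normal_setP N). Qed.
Let NF x y : N x -> N y -> N (x / y).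
Proof. by case: (normal_setP N) => _ NF _; apply: NF. Qed.
Let NJ x g : N x -> N (x ^ g).
Proof. by case: (normal_setP N) => _ _; apply. Qed.
Let NV x : N x -> N x^-1.
Proof. by move=> /(NF N1); rewrite mul1g. Qed.
Let NM x y : N x -> N y -> N (x * y).
Proof. by move=> Nx /NV /(NF Nx); rewrite invgK. Qed.

Definition coset_rel : rel G := fun x y => `[< N (x^-1 * y) >].

Lemma coset_rel_equiv : equiv_class_of coset_rel.
Proof.
split=> [x|x y|y x z].
- by apply/asboolP; rewrite mulVg.
- by apply/asboolP/asboolP => /NV; rewrite invgM invgK.
- move=> /asboolP xy /asboolP yz; apply/asboolP.
  by have := NM xy yz; rewrite mulgA mulgK.
Qed.

Canonical coset_equiv := EquivRelPack coset_rel_equiv.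

Definition quot := {eq_quot coset_rel}%qT.
HB.instance Definition _ := Choice.on quot.
HB.instance Definition _ := EqQuotient.on quot.

Definition quot_map (x : G) : quot := (\pi_quot x)%qT.

Lemma quot_mapP x y : quot_map x = quot_map y <-> N (x^-1 * y).
Proof.
split; first by move=> /eqmodP/asboolP.
by move=> Nxy; apply/eqmodP/asboolP.
Qed.

Let repr_map (u : quot) : quot_map (repr u) = u.
Proof. exact: reprK. Qed.

Definition quot_one : quot := quot_map 1.
Definition quot_mul (u v : quot) : quot := quot_map (repr u * repr v).
Definition quot_inv (u : quot) : quot := quot_map (repr u)^-1.

Lemma quot_map_mul x y : quot_mul (quot_map x) (quot_map y) = quot_map (x * y).
Proof.
apply/quot_mapP; set x' := repr _; set y' := repr _.
have Nx : N (x'^-1 * x) by apply/quot_mapP; exact: repr_map.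
have Ny : N (y'^-1 * y) by apply/quot_mapP; exact: repr_map.
have := NM (NJ y' Nx) Ny.
by rewrite /conjg invgM !mulgA mulgK.
Qed.

Lemma quot_map_inv x : quot_inv (quot_map x) = quot_map x^-1.
Proof.
apply/quot_mapP; set x' := repr _.
have Nx : N (x'^-1 * x) by apply/quot_mapP; exact: repr_map.
by have := NJ x'^-1 (NV Nx); rewrite /conjg !invgM !invgK mulgK.
Qed.

Let quotP (P : quot -> Prop) : (forall x, P (quot_map x)) -> forall u, P u.
Proof. by move=> Px u; rewrite -(repr_map u). Qed.

Fact quot_mulA : associative quot_mul.
Proof.
elim/quotP => x; elim/quotP => y; elim/quotP => z.
by rewrite !quot_map_mul mulgA.
Qed.
Fact quot_mul1 : left_id quot_one quot_mul.
Proof. by elim/quotP => x; rewrite quot_map_mul mul1g. Qed.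
Fact quot_mulr1 : right_id quot_one quot_mul.
Proof. by elim/quotP => x; rewrite quot_map_mul mulg1. Qed.
Fact quot_mulV : left_inverse quot_one quot_inv quot_mul.
Proof. by elim/quotP => x; rewrite quot_map_inv quot_map_mul mulVg. Qed.
Fact quot_mulrV : right_inverse quot_one quot_inv quot_mul.
Proof. by elim/quotP => x; rewrite quot_map_inv quot_map_mul mulgV. Qed.

HB.instance Definition _ :=
  isGroup.Build quot quot_mulA quot_mul1 quot_mulr1 quot_mulV quot_mulrV.

Lemma quot_map_is_morphism : monoid.monoid_morphism quot_map.
Proof. by split=> // x y; rewrite -quot_map_mul. Qed.

HB.instance Definition _ :=
  isUMagmaMorphism.Build G quot quot_map quot_map_is_morphism.

End Quotient.

Lemma center_is_normal (G : groupType) :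
  is_normal_subgroup [set z : G | forall x, commute z x].
Proof.
split=> /= [x|x y Zx Zy z|x g Zx]; first exact/commute_sym/commute1.
- apply/commute_sym/commuteM; first exact/commute_sym.
  exact/commuteV/commute_sym.
- by rewrite /conjg Zx mulKg.
Qed.

Definition center (G : groupType) : normal_subgroup G :=
  NormalSubgroup (center_is_normal G).

Lemma normal_closure_is_normal (G : groupType) (A : set G) :
  is_normal_subgroup (smallest (@is_normal_subgroup G) A).
Proof.
split=> [N [[]//]|x y Ax Ay N NA|x g Ax N NA].
- by case: (NA) => -[_ NF _] _; apply: NF; [apply: Ax|apply: Ay].
- by case: (NA) => -[_ _ NJ] _; apply: NJ; apply: Ax.
Qed.

Definition normal_closure (G : groupType) (A : set G) : normal_subgroup G :=
  NormalSubgroup (normal_closure_is_normal A).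

(* A letter (x, false) stands for the generator x, (x, true) for its inverse;
   the elements of the free group are the reduced words. *)
Section FreeGroup.
Variable X : choiceType.
Implicit Types (l : X * bool) (u v w : seq (X * bool)).

Definition inv_letter l := (l.1, ~~ l.2).

Definition reduced w := sorted (fun l m => m != inv_letter l) w.

Definition push_letter l w :=
  if w is m :: w' then if m == inv_letter l then w' else l :: w else [:: l].

Record free_group := FreeGroup {
  word_of :> seq (X * bool);
  word_ofP : reduced word_of
}.
HB.instance Definition _ := [isSub for word_of].
HB.instance Definition _ := [Choice of free_group by <:].

Lemma inv_letterK : involutive inv_letter.
Proof. by case=> x e; rewrite /inv_letter negbK. Qed.

Lemma reduced_push l w : reduced w -> reduced (push_letter l w).
Proof.
case: w => [|m w] //=; case: ifPn => [_ /path_sorted //|nlm].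
by rewrite /reduced /= nlm.
Qed.

Lemma push_letterK l w :
  reduced w -> push_letter (inv_letter l) (push_letter l w) = w.
Proof.
case: w => [|m w] /=; first by rewrite inv_letterK eqxx.
case: ifPn => [/eqP-> {m}|nlm _] /=; last by rewrite inv_letterK eqxx.
by case: w => [|k w] //= /andP[/negPf->].
Qed.

Definition concat u v := foldr push_letter v u.

Lemma reduced_concat u v : reduced v -> reduced (concat u v).
Proof. by move=> rv; elim: u => //= l u /reduced_push. Qed.

Lemma concat_push l u v :
  reduced v -> concat (push_letter l u) v = push_letter l (concat u v).
Proof.
move=> rv; case: u => [|m u] //=; case: ifPn => [/eqP->|] //=.
have := push_letterK (inv_letter l) (reduced_concat u rv).
by rewrite inv_letterK => ->.
Qed.

Lemma concat_nil u : reduced u -> concat u [::] = u.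
Proof.
elim: u => //= l u IHu ru; rewrite IHu; last exact: path_sorted ru.
by case: u ru {IHu} => [|m u] //= /andP[/negPf->].
Qed.

Lemma concatA u v w :
  reduced w -> concat u (concat v w) = concat (concat u v) w.
Proof. by move=> rw; elim: u => //= l u ->; rewrite concat_push. Qed.

Definition inv_word w := rev (map inv_letter w).

Lemma inv_wordK : involutive inv_word.
Proof. by move=> w; rewrite /inv_word map_rev revK mapK //; exact: inv_letterK. Qed.

Lemma reduced_inv w : reduced w -> reduced (inv_word w).
Proof.
rewrite /reduced /inv_word rev_sorted sorted_map; apply: sub_sorted => l m /=.
by rewrite !inv_letterK /= eq_sym.
Qed.

Lemma concat_cat u1 u2 v : concat (u1 ++ u2) v = concat u1 (concat u2 v).
Proof. exact: foldr_cat. Qed.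

Lemma concatVK u v : reduced v -> concat (inv_word u) (concat u v) = v.
Proof.
move=> rv; elim: u => //= l u IHu.
rewrite /inv_word /= rev_cons -cats1 concat_cat /=.
by rewrite push_letterK ?reduced_concat.
Qed.

Definition free_one : free_group := @FreeGroup [::] isT.
Definition free_mul (u v : free_group) : free_group :=
  FreeGroup (reduced_concat u (word_ofP v)).
Definition free_inv (u : free_group) : free_group :=
  FreeGroup (reduced_inv (word_ofP u)).

Fact free_mulA : associative free_mul.
Proof. by move=> u v w; apply/val_inj/concatA/word_ofP. Qed.
Fact free_mul1 : left_id free_one free_mul.
Proof. by move=> u; apply/val_inj. Qed.
Fact free_mulr1 : right_id free_one free_mul.
Proof. by move=> u; apply/val_inj/concat_nil/word_ofP. Qed.
Fact free_mulV : left_inverse free_one free_inv free_mul.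
Proof.
move=> u; apply/val_inj => /=.
by rewrite -[X in concat _ X](concat_nil (word_ofP u)) concatVK.
Qed.
Fact free_mulrV : right_inverse free_one free_inv free_mul.
Proof.
move=> u; apply/val_inj => /=; have ru := reduced_inv (word_ofP u).
by rewrite -[X in concat X _]inv_wordK -[X in concat _ X](concat_nil ru) concatVK.
Qed.

HB.instance Definition _ :=
  isGroup.Build free_group free_mulA free_mul1 free_mulr1 free_mulV free_mulrV.

Definition free_gen (x : X) : free_group := @FreeGroup [:: (x, false)] isT.

End FreeGroup.

(* A pair (U, V) in R stands for the relation U = V. *)
Definition relators (X : choiceType) (R : set (free_group X * free_group X)) :
    set (free_group X) :=
  [set r.1 * r.2^-1 | r in R].

Definition presented (X : choiceType) (R : set (free_group X * free_group X)) :
    groupType :=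
  quot (normal_closure (relators R)).

Definition presented_gen (X : choiceType)
    (R : set (free_group X * free_group X)) (x : X) : presented R :=
  quot_map (normal_closure (relators R)) (free_gen x).

Section SpecialLinear.
Variable n : nat.
Local Open Scope ring_scope.

Record SL := MkSL { SL_mx :> 'M[int]_n; SL_det : \det SL_mx == 1 }.
HB.instance Definition _ := [isSub for SL_mx].
HB.instance Definition _ := [Choice of SL by <:].

Fact SL_one_det : \det (1%:M : 'M[int]_n) == 1.
Proof. by rewrite det1. Qed.
Fact SL_mul_det (A B : SL) : \det (A *m B) == 1.
Proof. by rewrite det_mulmx (eqP (SL_det A)) (eqP (SL_det B)) mulr1. Qed.
Fact SL_inv_det (A : SL) : \det (\adj A) == 1.
Proof.
have /(congr1 determinant) := mul_mx_adj A.
by rewrite det_mulmx (eqP (SL_det A)) mul1r det1 => ->.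
Qed.

Definition SL_one := MkSL SL_one_det.
Definition SL_mul (A B : SL) := MkSL (SL_mul_det A B).
Definition SL_inv (A : SL) := MkSL (SL_inv_det A).

Fact SL_mulA : associative SL_mul.
Proof. by move=> A B C; apply/val_inj/mulmxA. Qed.
Fact SL_mul1 : left_id SL_one SL_mul.
Proof. by move=> A; apply/val_inj/mul1mx. Qed.
Fact SL_mulr1 : right_id SL_one SL_mul.
Proof. by move=> A; apply/val_inj/mulmx1. Qed.
Fact SL_mulV : left_inverse SL_one SL_inv SL_mul.
Proof. by move=> A; apply/val_inj; rewrite /= mul_adj_mx (eqP (SL_det A)). Qed.
Fact SL_mulrV : right_inverse SL_one SL_inv SL_mul.
Proof. by move=> A; apply/val_inj; rewrite /= mul_mx_adj (eqP (SL_det A)). Qed.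

HB.instance Definition _ :=
  isGroup.Build SL SL_mulA SL_mul1 SL_mulr1 SL_mulV SL_mulrV.

End SpecialLinear.

Definition PSL (n : nat) : groupType := quot (center (SL n)).

Definition PSL_proj (n : nat) : SL n -> PSL n := quot_map (center (SL n)).

Section Generators.
Variable n : nat.
Local Open Scope ring_scope.

(* Indices are 1-based; E_{i,j} = 0 if i or j lies outside 1, ..., n. *)
Definition mx_unit (i j : nat) : 'M[int]_n :=
  \matrix_(k, l) ((k.+1 == i) && (l.+1 == j))%:R.

Definition a_mx : 'M[int]_n :=
  \sum_(1 <= i < n) mx_unit i i.+1 + (-1) ^+ n.-1 *: mx_unit n 1.

Definition b_mx : 'M[int]_n := 1%:M + mx_unit 2 1.

End Generators.

Lemma a_mxE (n : nat) (k l : 'I_n) :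
  (a_mx n k l = (k.+1 == l :> nat)%:R
                + (-1) ^+ n.-1 * ((k.+1 == n) && (l == 0 :> nat))%:R)%R.
Proof.
rewrite !mxE eqSS; congr (_ + _)%R; rewrite summxE.
under eq_bigr do rewrite mxE eqSS.
have [kn|] := ltnP k.+1 n; last first.
  move=> nk; rewrite big_nat big1 => [|i /andP[_ ilt]].
    by rewrite eqn_leq [(k.+1 <= l)%N]leqNgt (leq_trans (ltn_ord l) nk).
  by rewrite gtn_eqF // (leq_trans ilt nk).
rewrite (bigD1_seq k.+1) ?iota_uniq ?mem_index_iota //= eqxx /= eq_sym.
by rewrite big1 ?addr0 // => i; rewrite eq_sym => /negPf->.
Qed.

Lemma a_mx_det (n : nat) : (\det (a_mx n) == 1)%R.
Proof.
case: n => [|n]; first by rewrite det_mx00.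
rewrite (expand_det_col _ ord0) (bigD1 ord_max) //= big1 ?addr0 => [|i ni].
  rewrite a_mxE /= !eqxx add0r mulr1 /cofactor /= addn0 mulrA -exprD -signr_odd.
  rewrite oddD addbb expr0 mul1r.
  suff -> : row' ord_max (col' ord0 (a_mx n.+1)) = 1%:M%R by rewrite det1.
  apply/matrixP=> i j; rewrite mxE mxE a_mxE mxE /= /bump leqNgt ltn_ord /=.
  by rewrite andbF mulr0 addr0 eqSS.
rewrite a_mxE /= eqSS (_ : (i == n :> nat) = false) ?mulr0 ?addr0 ?mul0r //.
by apply/negbTE; apply: contraNneq ni => /= ?; apply/eqP/val_inj.
Qed.

Lemma b_mx_det (n : nat) : (\det (b_mx n) == 1)%R.
Proof.
rewrite det_trig; last first.
  apply/is_trig_mxP => i j ij; rewrite !mxE -val_eqE /= ltn_eqF // add0r.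
  by rewrite !eqSS; case: j ij => -[|j] //= _ _; rewrite andbF.
rewrite big1 // => i _; rewrite !mxE eqxx !eqSS.
by case: (nat_of_ord i) => [|[|?]]; rewrite addr0.
Qed.

Definition a_SL (n : nat) : SL n := MkSL (a_mx_det n).
Definition b_SL (n : nat) : SL n := MkSL (b_mx_det n).

(* The words are evaluated at two elements a, b of an arbitrary group; the
   words themselves are the values at the generators of the free group.
   Indices are 1-based; outside 1 <= i != j <= n the values are meaningless. *)
Section Words.
Variables (G : groupType) (n : nat) (a b : G).

(* tau_{r+1,r} for 1 <= r <= n-1 *)
Definition tau_subdiag (r : nat) : G := a ^- r.-1 * b * a ^+ r.-1.

(* the exponent (-1)^(n-1) is 1 for odd n and -1 for even n *)
Definition tau_1n : G :=
  let t := a ^- n.-1 * b * a ^+ n.-1 in if odd n then t else t^-1.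

(* tau_{j+d,j} for d >= 1 *)
Fixpoint tau_lower (d j : nat) : G :=
  match d with
  | 0 => 1
  | 1 => tau_subdiag j
  | d'.+1 => [~ tau_lower d' j.+1, tau_subdiag j]
  end.

(* tau_{i,n} for 1 <= i <= n-1 *)
Definition tau_lastcol (i : nat) : G :=
  if i == 1%N then tau_1n else [~ tau_lower i.-1 1, tau_1n].

Definition tau (i j : nat) : G :=
  if (j < i)%N then tau_lower (i - j) j
  else if j == n then tau_lastcol i
  else [~ tau_lastcol i, tau_lower (n - j) j].

Definition weyl (i : nat) : G := tau i i.+1 * (tau i.+1 i)^-1 * tau i i.+1.

Definition in_range (i : nat) : Prop := (1 <= i <= n)%N.

Inductive relations : G * G -> Prop :=
| rel_commute i j k l of
    in_range i & in_range j & in_range k & in_range l &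
    i <> j & k <> l & (i, j) <> (k, l) & i <> l & j <> k :
    relations ([~ tau i j, tau k l], 1)
| rel_steinberg i j k of
    in_range i & in_range j & in_range k & i <> j & j <> k & i <> k :
    relations ([~ tau i j, tau j k], tau i k)
| rel_weyl4 :
    relations (weyl 1 ^+ 4, 1)
| rel_a :
    relations (a, \prod_(i <- rev (iota 1 n.-1)) weyl i).

End Words.

(* Generators of the free group of rank two: a is false, b is true. *)
Definition word_a : free_group bool := free_gen false.
Definition word_b : free_group bool := free_gen true.

Definition Rn (n : nat) : set (free_group bool * free_group bool) :=
  relations n word_a word_b.

Definition presents_PSL (n : nat) (R : set (free_group bool * free_group bool))
    (phi : presented R -> PSL n) : Prop :=
  [/\ group_isomorphism phi,
      phi (presented_gen R false) = PSL_proj (a_SL n)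
    & phi (presented_gen R true) = PSL_proj (b_SL n)].

(* Main.v *)
From HB Require Import structures.
Require Import Defs.
From mathcomp Require Import all_boot all_order all_algebra perm.
From mathcomp Require Import boolp classical_sets.
From mathcomp Require Import zify.

Set Implicit Arguments.
Unset Strict Implicit.
Unset Printing Implicit Defensive.

Import GRing.Theory Num.Theory.

Local Open Scope group_scope.

(** The words [tau i j] evaluate, at the matrices of the statement, to the
    elementary matrices 1 + E_ij, so that the relations of the presentation
    hold in SL_n(Z). In the presented group the elements x_ij = [tau i j]
    generate: b is x_21, and the last relation writes a as a product of the
    elements w_ij = x_ij x_ji^-1 x_ij. What the other relations say is that the
    x_ij satisfy the Steinberg relations and that w_12^4 = 1. So the heart of
    the matter is the theorem of Milnor and Silvester that for n >= 3 the
    Steinberg group of Z modulo w_12^4 is SL_n(Z) ([steinberg_faithful]).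

    The argument is Silvester's. Let g be a word in the x_ij with i, j <= m
    that maps to the identity matrix, and follow the l1 norm of row m along the
    word. Where the norm rises weakly and then falls, the Steinberg relations
    replace the two letters by a detour through vectors of smaller norm, up to
    an element of the group W generated by the w_ij, which merely permutes
    coordinates up to sign ([peak]). Hence g can be rewritten as p w followed
    by letters that never lower the norm, where w is in W and p is a word that
    visibly fixes e_m ([climb]). For our g the norm ends at 1, its least value,
    so it is 1 all along and nothing but p w is left ([climb_norm1]). Now w
    fixes e_m, and because the w_ij have order dividing 4 it is a word in the
    w_ij with i, j < m ([weyl_stabilizer]). The word p is the product of a word
    with indices below m and a product of powers of the commuting x_im, which
    are read off from the last column ([unip_faithful]). Hence g is a word with
    indices below m ([faithful_step]), and descending to m = 0 gives g = 1.

    It follows that the kernel of the map from the free group to SL_n(Z) is the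
    normal closure of the relators ([eval_SL_kernel]); the map is onto by the
    Euclidean algorithm ([SL_generated]). A central matrix is 1 or -1
    ([center_scalar]). For odd n the determinant excludes -1, so the centre is
    trivial. For even n the matrix -1 is the n-th power of a_n ([a_pow_n]), so
    the relation a^n = 1 kills exactly the centre. *)

(** * Words over a set of letters *)
Section GroupFacts.
Variable G : groupType.
Implicit Types (g h : G) (A B : G -> Prop).

Inductive word_in A : G -> Prop :=
| word_in1 : word_in A 1
| word_inMr g l : word_in A g -> A l -> word_in A (g * l).

Lemma word_in_letter A l : A l -> word_in A l.
Proof. by move=> Al; rewrite -[l]mul1g; apply: word_inMr => //; constructor. Qed.

Lemma word_inM A g h : word_in A g -> word_in A h -> word_in A (g * h).
Proof.
move=> Ag; elim=> [|h' l _ IH Al]; first by rewrite mulg1.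
by rewrite mulgA; apply: word_inMr.
Qed.

Lemma word_inV A g :
  (forall l, A l -> A l^-1) -> word_in A g -> word_in A g^-1.
Proof.
move=> AV; elim=> [|g' l _ IH Al]; first by rewrite invg1; constructor.
by rewrite invgM; apply: word_inM => //; apply/word_in_letter/AV.
Qed.

Lemma word_in_sub A B g :
  (forall l, A l -> word_in B l) -> word_in A g -> word_in B g.
Proof.
move=> AB; elim=> [|g' l _ IH Al]; first by constructor.
by apply: word_inM => //; apply: AB.
Qed.

Lemma word_inJ A t g :
  (forall l, A l -> word_in A (l ^ t)) -> word_in A g -> word_in A (g ^ t).
Proof.
move=> AJ; elim=> [|g' l _ IH Al]; first by rewrite conj1g; constructor.
by rewrite conjMg; apply: word_inM => //; apply: AJ.
Qed.

Lemma conjg_commute g h : commute g h -> g ^ h = g.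
Proof. by rewrite /commute conjgE => ->; rewrite mulKg. Qed.

End GroupFacts.

(** * Elementary matrices acting on integer row vectors *)
Section Norm.
Local Open Scope ring_scope.
Variable n : nat.
Implicit Types (v : 'rV[int]_n) (i j : 'I_n) (e : bool).

(** Natural-number valued, to serve as an induction measure. *)
Definition l1 v : nat := (\sum_(j < n) absz (v 0%R j))%N.

Definition negif e (z : int) := if e then - z else z.

(** The image of x_ij, or of its inverse when e is true: on row vectors it adds
    plus or minus coordinate i to coordinate j. *)
Definition elem_mx e i j : 'M[int]_n := 1%:M + negif e 1 *: delta_mx i j.

Lemma mul_elemE v e i j l :
  (v *m elem_mx e i j) 0 l = if l == j then v 0 l + negif e (v 0 i) else v 0 l.
Proof.
rewrite /elem_mx mulmxDr mulmx1 -scalemxAr !mxE (bigD1 i) //= big1 => [|k ki].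
  by rewrite mxE eqxx addr0 /=; case: (l == j); case: e => /=; lia.
by rewrite mxE (negPf ki) mulr0.
Qed.

Lemma l1_elem v e i j :
  (l1 (v *m elem_mx e i j) + absz (v 0%R j)%R = l1 v + absz (v 0 j + negif e (v 0 i))%R)%N.
Proof.
rewrite /l1 (bigD1 j) //= mul_elemE eqxx [in RHS](bigD1 j) //=.
rewrite (eq_bigr (fun k => absz (v 0%R k))) => [|k /negPf kj]; last by rewrite mul_elemE kj.
lia.
Qed.

End Norm.

Lemma ord_neq n (i j : 'I_n) : i < j -> (i != j) && (j != i).
Proof. by rewrite -!(inj_eq val_inj) /=; lia. Qed.

(** * Steinberg relations and conjugation by Weyl elements *)
Section Steinberg.
Variables (G : groupType) (n : nat) (x : 'I_n -> 'I_n -> G).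
Implicit Types (i j k l : 'I_n) (c d e : bool) (v : 'rV[int]_n).
Hypothesis n_ge3 : 2 < n.
Hypothesis x_commute : forall i j k l,
  i != j -> k != l -> i != l -> j != k -> commute (x i j) (x k l).
Hypothesis x_comm : forall i j k,
  i != j -> j != k -> i != k -> [~ x i j, x j k] = x i k.

(** The flag e = true stands for the exponent -1, so that exponents multiply by
    exclusive or. *)
Definition xs e i j := if e then (x i j)^-1 else x i j.

(** In SL_n(Z) this is the monomial matrix e_i -> e_j, e_j -> - e_i. *)
Definition wl i j := x i j * (x j i)^-1 * x i j.

Lemma xsV e i j : (xs e i j)^-1 = xs (~~ e) i j.
Proof. by case: e => //=; rewrite invgK. Qed.

Lemma xsVJ e i j t : xs e i j ^ t = if e then (x i j ^ t)^-1 else x i j ^ t.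
Proof. by case: e => //=; rewrite conjVg. Qed.

Lemma xs_commute d e i j k l :
  i != j -> k != l -> i != l -> j != k -> commute (xs d i j) (xs e k l).
Proof.
move=> ij kl il jk; have c := x_commute ij kl il jk.
by case: d e => -[] //=; do ?[exact: commuteV | apply/commute_sym; exact: commuteV
  | apply/commuteV/commute_sym/commuteV/commute_sym].
Qed.

Lemma exists_third_index i j : exists k, (k != i) && (k != j).
Proof.
case: (pickP [pred k | (k != i) && (k != j)]) => [k kP|no]; first by exists k.
have : #|[set: 'I_n]| <= #|[set i; j]|.
  apply/subset_leq_card/fintype.subsetP => k _; have := no k; rewrite /= !inE.
  by case: eqP => //= _ /negbFE.
by rewrite cardsT card_ord cards2; case: (_ != _); lia.
Qed.

Lemma xJl i j k : i != j -> j != k -> i != k ->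
  x j k ^ x i j = x j k * (x i k)^-1.
Proof.
move=> ij jk ik; have := x_comm ij jk ik; rewrite commgEr conjVg => <-.
by rewrite invgM invgK mulVKg.
Qed.

Lemma xJr i j k : i != j -> j != k -> i != k -> x i j ^ x j k = x i j * x i k.
Proof.
by move=> ij jk ik; have := x_comm ij jk ik; rewrite commgEl => <-; rewrite mulVKg.
Qed.

Lemma xJl_inv i j k : i != j -> j != k -> i != k ->
  x j k ^ (x i j)^-1 = x j k * x i k.
Proof.
move=> ij jk ik; apply: (can_inj (conjgK (x i j))); rewrite conjgKV.
have kj : k != j by rewrite eq_sym.
have ji : j != i by rewrite eq_sym.
have ki : k != i by rewrite eq_sym.
rewrite conjMg (xJl ij jk ik) (conjg_commute (x_commute ik ij _ _)) //.
by rewrite mulgVK.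
Qed.

Lemma xJr_inv i j k : i != j -> j != k -> i != k ->
  x i j ^ (x j k)^-1 = x i j * (x i k)^-1.
Proof.
move=> ij jk ik; apply: (can_inj (conjgK (x j k))); rewrite conjgKV.
have kj : k != j by rewrite eq_sym.
rewrite conjMg (xJr ij jk ik) conjVg.
by rewrite (conjg_commute (x_commute ik jk _ _)) // mulgK.
Qed.

Lemma xsJl d e i j k : i != j -> j != k -> i != k ->
  xs e j k ^ xs d i j = xs e j k * xs (~~ (d (+) e)) i k.
Proof.
move=> ij jk ik; have c : commute (x j k) (x i k).
  by apply: x_commute; rewrite // eq_sym.
have c' := commuteV c; rewrite xsVJ /=.
case: d e => -[] /=; rewrite ?xJl_inv ?xJl //.
  by rewrite c invgM.
by rewrite c' invgM invgK.
Qed.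

Lemma xsJr d e i j k : i != j -> j != k -> i != k ->
  xs d i j ^ xs e j k = xs d i j * xs (d (+) e) i k.
Proof.
move=> ij jk ik; have c : commute (x i j) (x i k).
  by apply: x_commute; rewrite // eq_sym.
have c' := commuteV c; rewrite xsVJ /=.
case: d e => -[] /=; rewrite ?xJr_inv ?xJr //.
  by rewrite c' invgM invgK.
by rewrite c invgM.
Qed.

Lemma xsR d e i j k : i != j -> j != k -> i != k ->
  [~ xs d i j, xs e j k] = xs (d (+) e) i k.
Proof. by move=> ij jk ik; rewrite commgEl xsJr // mulKg. Qed.

Section Conj.
Variables i j k : 'I_n.
Hypotheses (ij : i != j) (ik : i != k) (jk : j != k).

Let ji : j != i. Proof. by rewrite eq_sym. Qed.
Let ki : k != i. Proof. by rewrite eq_sym. Qed.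
Let kj : k != j. Proof. by rewrite eq_sym. Qed.

Lemma wJ1 : x i k ^ wl i j = x j k.
Proof.
rewrite /wl !conjgM (conjg_commute (x_commute ik ij _ _)) // xJl_inv // conjMg xJl //.
by rewrite (conjg_commute (x_commute ik ij _ _)) // [x i k * _]mulgA
   (x_commute ik jk) // mulgK.
Qed.

Lemma wJ2 : x j k ^ wl i j = (x i k)^-1.
Proof.
rewrite /wl !conjgM xJl // conjMg conjVg xJl_inv //.
have c : commute (x j k) (x j i)^-1 by apply/commuteV/x_commute.
rewrite (conjg_commute c) invgM mulVKg conjVg.
by rewrite (conjg_commute (x_commute ik ij _ _)).
Qed.

Lemma wJ3 : x k i ^ wl i j = x k j.
Proof.
rewrite /wl !conjgM xJr // conjMg xJr_inv //.
have c : commute (x k i) (x j i)^-1 by apply/commuteV/x_commute.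
rewrite (conjg_commute c) mulgA (x_commute ki kj) // mulgK.
by rewrite (conjg_commute (x_commute kj ij _ _)).
Qed.

Lemma wJ4 : x k j ^ wl i j = (x k i)^-1.
Proof.
rewrite /wl !conjgM (conjg_commute (x_commute kj ij _ _)) // xJr_inv // conjMg conjVg.
rewrite (conjg_commute (x_commute kj ij _ _)) // xJr // invgM mulVKg //.
Qed.

(** A conjugate of x_ij by elements involving only i and j cannot be computed
    directly: a third index k is needed to write x_ij as a commutator of
    elements whose conjugates are known. *)
Lemma wJ5 : x i j ^ wl i j = (x j i)^-1.
Proof.
rewrite -{1}(x_comm ik kj ij) conjRg wJ1 wJ4.
exact: (xsR false true jk ki ji).
Qed.

Lemma wJ6 : x j i ^ wl i j = (x i j)^-1.
Proof.
rewrite -{1}(x_comm jk ki ji) conjRg wJ2 wJ3.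
exact: (xsR true false ik kj ij).
Qed.

End Conj.

Lemma tpermE i j k : tperm i j k = if k == i then j else if k == j then i else k.
Proof. by case: tpermP => [->|->|/eqP/negPf-> /eqP/negPf->]; rewrite ?eqxx //; case: eqP. Qed.

(** Conjugation by w_ij moves the indices as the monomial matrix moves the basis
    vectors, with one sign for each index that equals j. *)
Lemma wJ i j k l : i != j -> k != l ->
  x k l ^ wl i j = xs ((k == j) (+) (l == j)) (tperm i j k) (tperm i j l).
Proof.
move=> ij kl; rewrite !tpermE.
have [m /andP[mi mj]] := exists_third_index i j.
have ji : j != i by rewrite eq_sym.
have [ki|ki] := altP (k =P i).
  subst k; rewrite (negPf ij) /=.
  have [->|lj] := altP (l =P j); first by rewrite (negPf ji);
    apply: (wJ5 (k := m)); rewrite // eq_sym.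
  by rewrite [l == i]eq_sym (negPf kl) /=; apply: wJ1; rewrite // eq_sym.
have [kj|kj] := altP (k =P j).
  subst k => /=.
  have [->|li] := altP (l =P i); first by rewrite (negPf ij);
    apply: (wJ6 (k := m)); rewrite // eq_sym.
  by rewrite [l == j]eq_sym (negPf kl) /=; apply: wJ2; rewrite // eq_sym.
have [->|li] := altP (l =P i).
  by rewrite (negPf ij) /=; apply: wJ3; rewrite // eq_sym.
have [->|lj] := altP (l =P j).
  by apply: wJ4; rewrite // eq_sym.
rewrite /= /wl; apply: conjg_commute.
by do ?apply: commuteM; do ?apply: commuteV; apply: x_commute; rewrite // eq_sym.
Qed.

Lemma wsJ e i j k l : i != j -> k != l ->
  xs e k l ^ wl i j = xs (e (+) (k == j) (+) (l == j)) (tperm i j k) (tperm i j l).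
Proof.
by move=> ij kl; rewrite xsVJ wJ //; case: e; rewrite // xsV -addNb; case: (_ == _).
Qed.

(** Being fixed by its own conjugation, w_ij equals x_ji^-1 x_ij x_ji^-1. *)
Lemma wlV i j : i != j -> (wl i j)^-1 = wl j i.
Proof.
move=> ij; have ji : j != i by rewrite eq_sym.
have e : wl i j ^ wl i j = wl i j by rewrite conjgE mulKg.
rewrite -{}e {1}/wl !conjMg conjVg !wJ // !tpermL !tpermR !eqxx (negPf ij) /=.
by rewrite /wl !invgM !invgK mulgA.
Qed.

Definition ws e i j := if e then wl j i else wl i j.

Lemma wsV e i j : i != j -> (ws e i j)^-1 = ws (~~ e) i j.
Proof. by move=> ij; case: e => /=; rewrite wlV // eq_sym. Qed.

Lemma wsE e i j : i != j -> ws e i j = xs e i j * xs (~~ e) j i * xs e i j.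
Proof.
by move=> ij; case: e => //=; rewrite -wlV // /wl !invgM !invgK mulgA.
Qed.

Lemma wlJ i j k l : i != j -> k != l ->
  wl k l ^ wl i j = ws ((k == j) (+) (l == j)) (tperm i j k) (tperm i j l).
Proof.
move=> ij kl; have lk : l != k by rewrite eq_sym.
rewrite {1}/wl !conjMg conjVg !wJ // xsV wsE 1?(inj_eq perm_inj) //.
by rewrite [(l == j) (+) _]addbC.
Qed.

Lemma wswJ e i j k l : i != j -> k != l ->
  ws e k l ^ wl i j = ws (e (+) (k == j) (+) (l == j)) (tperm i j k) (tperm i j l).
Proof.
move=> ij kl; have lk : l != k by rewrite eq_sym.
case: e => /=; rewrite wlJ //.
by case: (k == j) (l == j) => -[].
Qed.

(** When only the positions of the conjugates matter and not the signs, these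
    two forms are more convenient. *)
Lemma wsJs d e i j k l : i != j -> k != l ->
  exists c, ws e k l ^ ws d i j = ws c (tperm i j k) (tperm i j l).
Proof.
move=> ij kl; case: d => /=; last by eexists; rewrite wswJ.
by eexists; rewrite wswJ // 1?tpermC // eq_sym.
Qed.

Lemma xsJs d e i j k l : i != j -> k != l ->
  exists c, xs e k l ^ ws d i j = xs c (tperm i j k) (tperm i j l).
Proof.
move=> ij kl; case: d => /=; last by eexists; rewrite wsJ.
by eexists; rewrite wsJ // 1?tpermC // eq_sym.
Qed.

(** * Peak reduction *)
Section Peak.
Variable m : nat.

Definition weyl_letter (g : G) :=
  exists i j, [/\ i != j, i < m, j < m & g = wl i j].

Definition x_letter (g : G) :=
  exists e i j, [/\ i != j, i < m, j < m & g = xs e i j].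

Lemma weyl_letter_ws e i j : i != j -> i < m -> j < m -> weyl_letter (ws e i j).
Proof.
move=> ij im jm; case: e => /=; [exists j, i | exists i, j]; split=> //.
by rewrite eq_sym.
Qed.

Lemma weyl_letterV g : weyl_letter g -> weyl_letter g^-1.
Proof.
case=> i [j [ij im jm ->]].
rewrite -[wl i j]/(ws false i j) wsV //.
exact: weyl_letter_ws.
Qed.

Lemma x_letterV g : x_letter g -> x_letter g^-1.
Proof. by case=> e [i [j [ij im jm ->]]]; rewrite xsV; exists (~~ e), i, j. Qed.

(** A path for g from the vector v: elementary steps, each of which leads to a
    vector of norm less than N, closed by a norm-preserving Weyl element. *)
Inductive descends (N : nat) : 'rV[int]_n -> G -> Prop :=
| descends_weyl v om : word_in weyl_letter om -> descends N v om
| descends_step v e i j g : i != j -> i < m -> j < m ->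
    l1 (v *m elem_mx e i j)%R < N -> descends N (v *m elem_mx e i j)%R g ->
    descends N v (xs e i j * g).

(* Expresses the norms of all vectors in the goal through the coordinates of
   the initial vector, by [l1_elem] for each step, and then forgets what the
   coordinates are. *)
Ltac l1_lia :=
  repeat match goal with
  | H : is_true ?P |- _ => match P with
     | context [l1 _] => move: H | context [absz _] => move: H
     | context [fun_of_matrix _ _ _] => move: H end end;
  repeat match goal with |- context [l1 (mulmx ?v (elem_mx ?e ?i ?j))] =>
    have := l1_elem v e i j; generalize (l1 (mulmx v (elem_mx e i j))) end;
  rewrite ?mul_elemE ?eqxx;
  repeat match goal with
  | H : is_true (?a != ?b) |- _ =>
     rewrite ?(negPf H) ?[b == a]eq_sym ?(negPf H); clear H end;
  repeat match goal with |- context [fun_of_matrix ?v ?a ?b] =>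
    generalize (fun_of_matrix v a b) end;
  repeat match goal with |- context [l1 ?v] => generalize (l1 v) end;
  rewrite /negif;
  repeat match goal with e : bool |- _ => move: e => [] end;
  clear; cbv beta iota delta [negb addb]; lia.

(** By definition of w_ij a generator can be traded for two generators on the
    same pair of indices and a Weyl element. The first of them, x_ji, changes
    coordinate i instead of coordinate j. *)
Lemma xs_flip e i j : i != j ->
  xs e i j = xs e j i * (xs (~~ e) i j * ws e i j).
Proof.
by move=> ij; rewrite wsE // -!mulgA -!xsV mulKg mulVKg.
Qed.

Lemma xs_swapl a b k i j : k != i -> i != j -> k != j ->
  xs a i j * xs b k i = xs b k i * (xs (~~ (a (+) b)) k j * xs a i j).
Proof.
move=> ki ij kj; rewrite conjgC xsJl // addbC.
congr (_ * _); apply: xs_commute => //; rewrite eq_sym //.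
Qed.

Lemma xs_swapr a b i j k : i != j -> j != k -> i != k ->
  xs a i j * xs b j k = xs b j k * (xs (a (+) b) i k * xs a i j).
Proof.
move=> ij jk ik; rewrite conjgC xsJr //.
congr (_ * _); apply: xs_commute => //; rewrite eq_sym //.
Qed.

(** The letter y (with signs and indices d, i, j) does not raise the norm of v
    and the letter h (e, k, l) lowers it, so that the path y^-1, h from v y to
    v h passes over v. A path that stays below the norm of v is found in each
    configuration of the two pairs of indices. When neither letter changes a
    coordinate that the other one involves, it is h, y^-1. Otherwise the
    Steinberg relations yield paths with a third generator, and [xs_flip] yields
    another one; the sizes of the coordinates decide which of them stays low. *)
Lemma peak v d i j e k l :
  i != j -> k != l -> i < m -> j < m -> k < m -> l < m ->
  l1 (v *m elem_mx d i j)%R <= l1 v -> l1 (v *m elem_mx e k l)%R < l1 v ->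
  descends (l1 v) (v *m elem_mx d i j)%R (xs (~~ d) i j * xs e k l).
Proof.
move=> ij kl im jm km lm ly lh.
have D0 w : descends (l1 v) w 1 by apply/descends_weyl/word_in1.
have Dweyl w c (p q : 'I_n) : p != q -> p < m -> q < m -> descends (l1 v) w (ws c p q).
  by move=> *; apply/descends_weyl/word_in_letter/weyl_letter_ws.
have Dlast w c (p q : 'I_n) : p != q -> p < m -> q < m ->
    l1 (w *m elem_mx c p q)%R < l1 v -> descends (l1 v) w (xs c p q).
  by move=> pq pm qm lt; rewrite -[xs _ _ _]mulg1; apply: descends_step.
have C := xs_commute.
have ji : j != i by rewrite eq_sym.
have lk : l != k by rewrite eq_sym.
have [il|il] := altP (i =P l); have [jk|jk] := altP (j =P k).
- subst k l; have {ij lk kl} ji : j != i by rewrite eq_sym.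
  have de : d = e by move: d e ly lh => [] [] //; l1_lia.
  (* The two letters are two thirds of a Weyl element. *)
  subst e; rewrite [xs d j i]xs_flip // -xsV mulKg.
  apply: descends_step => //; first by l1_lia.
  exact: Dweyl.
- subst l; have kj : k != j by rewrite eq_sym.
  have [vki|vki] := leqP (absz (v 0%R k)) (absz (v 0%R i)).
  (* Swapping the letters is harmless unless h overshoots coordinate i, in
     which case coordinate k is lowered first. *)
  + rewrite xs_swapl // addNb negbK.
    apply: descends_step => //; first by l1_lia.
    by apply: descends_step => //; [|apply: Dlast => //]; l1_lia.
  + rewrite [xs e k i]xs_flip // mulgA (C _ _ i j i k) // -!mulgA.
    apply: descends_step => //; first by l1_lia.
    apply: descends_step => //; first by l1_lia.
    by apply: descends_step => //; [l1_lia|exact: Dweyl].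
- subst k; have li : l != i by rewrite eq_sym.
  have [vij|vij] := leqP (absz (v 0%R i)) (absz (v 0%R j)).
  (* The mirror image of the previous case. *)
  + rewrite xs_swapr //.
    apply: descends_step => //; first by l1_lia.
    by apply: descends_step => //; [|apply: Dlast => //]; l1_lia.
  + rewrite (xs_flip (~~ d)) // negbK -!mulgA.
    have -> : ws (~~ d) i j * xs e j l = xs (~~ (d (+) e)) i l * ws (~~ d) i j.
      rewrite conjgCV wsV // negbK; congr (_ * _).
      case: d {ly} => /=; rewrite wsJ // tpermE eqxx.
        rewrite (negPf ji) (negPf li) addbF tpermE (negPf li).
        by rewrite [l == j]eq_sym (negPf kl) addbF negbK.
      by rewrite (negPf ji) tpermE [l == j]eq_sym (negPf kl) (negPf li) !addbF addbT.
    rewrite [X in _ * X]mulgA (C _ _ i j i l) // -!mulgA.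
    apply: descends_step => //; first by l1_lia.
    apply: descends_step => //; first by l1_lia.
    by apply: descends_step => //; [l1_lia|exact: Dweyl].
- have [jl|jl] := altP (j =P l); last first.
    rewrite C //.
    by apply: descends_step => //; [|apply: Dlast => //]; l1_lia.
  subst l; have [ik|ik] := altP (i =P k).
    subst k; have <- : d = e by move: d e ly lh => [] [] //; l1_lia.
    by rewrite -xsV mulVg.
  have ki : k != i by rewrite eq_sym.
  (* If coordinate i is zero then y fixes v. *)
  have [vi0|vi0] := leqP (absz (v 0%R i)) 0.
    rewrite C //.
    by apply: descends_step => //; [|apply: Dlast => //]; l1_lia.
  (* Both letters change coordinate j, and applying both can overshoot. One of
     the coordinates i and k is first reduced by the other one. *)
  have [vki|vki] := ltnP (absz (v 0%R k)) (2 * absz (v 0%R i)).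
  + have -> : xs (~~ d) i j * xs e k j =
      xs (~~ (d (+) e)) k i * (xs (~~ d) i j * xs (d (+) e) k i).
      rewrite -[xs (~~ (d (+) e)) k i]xsV -conjgE xsJl //; congr (_ * xs _ _ _).
      by case: d e {ly lh} => -[].
    apply: descends_step => //; first by l1_lia.
    by apply: descends_step => //; [|apply: Dlast => //]; l1_lia.
  + have -> : xs (~~ d) i j * xs e k j =
      xs (~~ (d (+) e)) i k * (xs e k j * xs (d (+) e) i k).
      rewrite -[xs (~~ (d (+) e)) i k]xsV -conjgE xsJl // C //; congr (_ * xs _ _ _).
      by case: d e {ly lh} => -[].
    apply: descends_step => //; first by l1_lia.
    by apply: descends_step => //; [|apply: Dlast => //]; l1_lia.
Qed.
End Peak.

Section Order4.
Let ord4 i j := wl i j ^+ 4 = 1.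

Lemma w4_ws c i j : i != j -> ws c i j ^+ 4 = 1 -> ord4 i j.
Proof.
move=> ij; case: c => //=; rewrite -[wl j i]/(ws (~~ false) i j) -wsV //.
by rewrite expVgn => /eqP; rewrite invg_eq1 => /eqP.
Qed.

Lemma w4_sym i j : i != j -> ord4 i j -> ord4 j i.
Proof. by move=> ij; apply: (@w4_ws true); rewrite eq_sym. Qed.

Lemma w4_right i j k : i != j -> i != k -> ord4 i j -> ord4 i k.
Proof.
move=> ij ik; have [->//|jk] := eqVneq j k; move=> h.
have ji : j != i by rewrite eq_sym.
have ki : k != i by rewrite eq_sym.
have [c] := wsJs false false jk ij; rewrite /= tpermL [tperm _ _ i]tpermD // => e.
by apply: (@w4_ws c) => //; rewrite -e -conjXg h conj1g.
Qed.

(** All w_ij are conjugate up to inversion. *)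
Lemma w4_all i0 j0 i j : i0 != j0 -> ord4 i0 j0 -> i != j -> ord4 i j.
Proof.
move=> ij0 h; have [<- ij|ii0 ij] := eqVneq i0 i; first exact: (w4_right ij0 ij h).
rewrite eq_sym in ii0.
apply: (@w4_right i i0) => //; apply: w4_sym; first by rewrite eq_sym.
by apply: (w4_right ij0 _ h); rewrite eq_sym.
Qed.
End Order4.

(** * Faithfulness: descent on the range of indices *)
Section Descent.
Hypothesis w4 : forall i j, i != j -> wl i j ^+ 4 = 1.

Variable rho : G -> 'M[int]_n.
Hypothesis rho1 : rho 1 = 1%:M%R.
Hypothesis rhoM : forall g h, rho (g * h) = (rho g *m rho h)%R.
Hypothesis rho_x : forall i j, i != j -> rho (x i j) = elem_mx false i j.

Lemma mul_elem_inv e i j : i != j -> (elem_mx e i j *m elem_mx (~~ e) i j = 1%:M)%R.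
Proof.
move=> ij; apply/row_matrixP => k; rewrite !rowE; apply/rowP => l.
rewrite mulmxA !mul_elemE mulmx1 (negPf ij).
by case: (l == j); case: e => /=; lia.
Qed.

Lemma rho_xs e i j : i != j -> rho (xs e i j) = elem_mx e i j.
Proof.
move=> ij; case: e => /=; last exact: rho_x.
have h : (rho (x i j)^-1 *m elem_mx false i j = 1%:M)%R by rewrite -rho_x // -rhoM mulVg.
by rewrite -[LHS]mulmx1 -(mul_elem_inv false ij) mulmxA h mul1mx.
Qed.

Lemma rho_wlE v i j l : i != j ->
  (v *m rho (wl i j))%R 0%R l
  = (if l == j then v 0 i else if l == i then - v 0 j else v 0 l)%R.
Proof.
move=> ij; have ji : j != i by rewrite eq_sym.
rewrite /wl !rhoM -[(x j i)^-1]/(xs true j i) -[x i j]/(xs false i j) !rho_xs //.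
rewrite !mulmxA !mul_elemE !eqxx ?(negPf ij) ?(negPf ji) /negif.
have [->|lj] := altP (l =P j); first by rewrite ?(negPf ji); lia.
by have [->|li] := altP (l =P i); rewrite ?(negPf ij) ?eqxx; lia.
Qed.

Lemma l1_wl v i j : i != j -> l1 (v *m rho (wl i j))%R = l1 v.
Proof.
move=> ij; have ji : j != i by rewrite eq_sym.
rewrite /l1 (bigD1 i) //= (bigD1 j) //= [in RHS](bigD1 i) //= [X in _ = _ + X](bigD1 j) //=.
rewrite !rho_wlE // !eqxx (negPf ij).
rewrite (eq_bigr (fun k => absz (v 0%R k))); first lia.
by move=> k /andP[ki kj]; rewrite rho_wlE // (negPf ki) (negPf kj).
Qed.

Lemma l1_weyl M v w : word_in (weyl_letter M) w -> l1 (v *m rho w)%R = l1 v.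
Proof.
elim=> [|w' l _ IH [i [j [ij _ _ ->]]]]; first by rewrite rho1 mulmx1.
by rewrite rhoM mulmxA l1_wl.
Qed.

Lemma l1_eq0 v : l1 v = 0 -> v = 0%R.
Proof.
move=> /eqP; rewrite /l1 sum_nat_eq0 => /forallP h; apply/rowP => j; rewrite mxE.
by have := h j; rewrite absz_eq0 => /eqP.
Qed.

Lemma x_letter_weyl M g w :
  x_letter M g -> word_in (weyl_letter M) w -> x_letter M (g ^ w).
Proof.
move=> xg; elim=> [|w' l _ [e [i [j [ij im jm E]]]] [k [p [kp km pm ->]]]].
  by rewrite conjg1.
rewrite conjgM E; have [c ->] := xsJs false e kp ij.
exists c, (tperm k p i), (tperm k p j); split=> //; first by rewrite (inj_eq perm_inj).
  by case: tpermP.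
by case: tpermP.
Qed.

Section Row.
Variable m : 'I_n.

Let vm : 'rV[int]_n := delta_mx 0%R m.
Let vec g := (vm *m rho g)%R.

Lemma vmE l : vm 0%R l = (l == m)%:R%R.
Proof. by rewrite /vm mxE eqxx. Qed.

Lemma l1_vm : l1 vm = 1%N.
Proof.
rewrite /l1 (bigD1 m) //= vmE eqxx big1 // => i im; by rewrite vmE (negPf im).
Qed.

(** Letters that fix the basis vector e_m because they add no multiple of
    coordinate m to another coordinate. *)
Definition stab_letter (g : G) :=
  exists e i j, [/\ i != j, i < m.+1, j < m.+1, i != m & g = xs e i j].

Lemma stab_letter_fix p : word_in stab_letter p -> vec p = vm.
Proof.
elim=> [|p' l _ IH [e [i [j [ij _ _ im ->]]]]]; first by rewrite /vec rho1 mulmx1.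
rewrite /vec rhoM mulmxA -/(vec p') IH rho_xs //; apply/rowP => k; rewrite mul_elemE !vmE.
by rewrite (negPf im); case: ifP; case: e => //=; rewrite ?oppr0 addr0.
Qed.

Lemma vec_neq0 g : 0 < l1 (vec g).
Proof.
rewrite lt0n; apply/eqP => /l1_eq0 h.
have : vm = 0%R by rewrite -[vm]mulmx1 -rho1 -(mulgV g) rhoM mulmxA -/(vec g) h mul0mx.
by move=> /rowP /(_ m); rewrite vmE eqxx mxE.
Qed.

(** Words of the form p w followed by letters along which the norm of row m
    never drops, where p fixes e_m and w is a Weyl word. *)
Inductive climb : G -> Prop :=
| climb_base p w :
    word_in stab_letter p -> word_in (weyl_letter m.+1) w -> climb (p * w)
| climb_step g e i j : climb g -> i != j -> i < m.+1 -> j < m.+1 ->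
    l1 (vec g) <= l1 (vec (g * xs e i j)) -> climb (g * xs e i j).

(** A Weyl element on the right can be moved past the letters, because it
    permutes them and preserves the norm. *)
Lemma climb_weyl g w : climb g -> word_in (weyl_letter m.+1) w -> climb (g * w).
Proof.
move=> cg gw; elim: cg => [p w' gp gw'|{}g e i j _ IH ij im jm lg].
  by rewrite -mulgA; apply: climb_base => //; apply: word_inM.
have E : g * xs e i j * w = g * w * (xs e i j ^ w) by rewrite -!mulgA -conjgC.
have : x_letter m.+1 (xs e i j ^ w) by apply: x_letter_weyl => //; exists e, i, j.
case=> [e' [i' [j' [ij' im' jm' E']]]].
move: lg; rewrite -(l1_weyl _ gw) -[l1 (vec (_ * xs _ _ _))](l1_weyl _ gw).
rewrite /vec -!mulmxA -!rhoM E E'; exact: climb_step.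
Qed.

Lemma climb_descends N v t : descends m.+1 N v t ->
  (forall g, climb g -> l1 (vec g) < N -> forall e i j, i != j -> i < m.+1 ->
     j < m.+1 -> climb (g * xs e i j)) ->
  forall g, climb g -> vec g = v ->
    (forall e i j, i != j -> i < m.+1 -> j < m.+1 -> climb (g * xs e i j)) ->
  climb (g * t).
Proof.
move=> + IHN; elim=> [{}v om gom|{}v e i j {}t ij im jm lt _ IH] g cg vg stp.
  exact: climb_weyl.
have vE : vec (g * xs e i j) = (v *m elem_mx e i j)%R.
  by rewrite /vec rhoM mulmxA -/(vec g) vg rho_xs.
rewrite mulgA; apply: IH; [exact: stp|exact: vE|].
by apply: IHN; [exact: stp|rewrite vE].
Qed.

(** If the new letter lowers the norm, the last letter of g and the new one form
    a peak. Its detour is absorbed letter by letter: at every vertex below the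
    top by induction on the norm, and at the starting vertex, which may have the
    same norm as the top, by induction on the length of g. *)
Lemma climb_closed g e i j :
  climb g -> i != j -> i < m.+1 -> j < m.+1 -> climb (g * xs e i j).
Proof.
suff H N : forall g, climb g -> l1 (vec g) < N -> forall e i j, i != j -> i < m.+1 ->
     j < m.+1 -> climb (g * xs e i j) by move=> cg *; apply: (H (l1 (vec g)).+1).
elim: N => // N IHN {e i j} {}g.
elim=> [p w gp gw _|{}g d i j cg IHg ij im jm lg] => [e i j ij im jm|gN e k l kl km lm].
  apply: climb_step => //; first exact: climb_base.
  rewrite [vec (p * w)]/vec rhoM mulmxA (l1_weyl _ gw) -/(vec p) (stab_letter_fix gp) l1_vm.
  exact: vec_neq0.
have [le|lt] := leqP (l1 (vec (g * xs d i j))) (l1 (vec (g * xs d i j * xs e k l))).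
  by apply: climb_step => //; apply: climb_step.
set v := vec (g * xs d i j).
have vV : (v *m elem_mx (~~ d) i j)%R = vec g.
  by rewrite /v /vec rhoM -!mulmxA rho_xs // mul_elem_inv // mulmx1.
have vh : (v *m elem_mx e k l)%R = vec (g * xs d i j * xs e k l).
  by rewrite /v /vec [in RHS]rhoM mulmxA rho_xs.
have := @peak m.+1 v (~~ d) i j e k l ij kl im jm km lm.
rewrite vV vh => /(_ lg lt) /climb_descends D; rewrite -mulgA -[d]negbK; apply: D => //.
  move=> g' cg' lt'; apply: IHN => //; apply: leq_trans lt' _; by rewrite -ltnS.
by apply: IHg; apply: leq_ltn_trans lg _.
Qed.

Lemma x_letter_climb g : word_in (x_letter m.+1) g -> climb g.
Proof.
elim=> [|g' l _ IH [e [i [j [ij im jm ->]]]]]; last exact: climb_closed.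
by rewrite -(mulg1 1); apply: climb_base; constructor.
Qed.

(** While the norm stays 1, a letter after p w cannot add the only nonzero
    coordinate to another one. Moved to the left of w it is therefore a letter
    that fixes e_m and can join p. *)
Lemma climb_norm1 g : climb g -> l1 (vec g) <= 1%N ->
  exists p w, [/\ word_in stab_letter p, word_in (weyl_letter m.+1) w & g = p * w].
Proof.
elim=> [p w gp gw _|{}g e i j _ IH ij im jm le1 le2]; first by exists p, w.
have [p [w [gp gw E]]] := IH (leq_trans le1 le2).
have gwV : word_in (weyl_letter m.+1) w^-1 by apply: word_inV => // l; apply: weyl_letterV.
have : x_letter m.+1 (xs e i j ^ w^-1) by apply: x_letter_weyl => //; exists e, i, j.
case=> [e' [i' [j' [ij' im' jm' E']]]].
have {}E : g * xs e i j = p * xs e' i' j' * w.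
  by rewrite E -E' -mulgA [w * _]conjgCV mulgA.
exists (p * xs e' i' j'), w; split=> //; apply: word_inMr => //.
exists e', i', j'; split=> //; apply/eqP => im'E; subst i'.
move: le2; rewrite E /vec rhoM mulmxA (l1_weyl _ gw) rhoM mulmxA -/(vec p).
rewrite (stab_letter_fix gp) rho_xs //; have := l1_elem vm e' m j'.
rewrite !vmE eqxx [j' == m]eq_sym (negPf ij') l1_vm.
by case: e' {E E'} => /=; lia.
Qed.

(** ** The stabilizer of a basis vector in the Weyl group *)
Section Coset.
Variable o : 'I_n.
Hypothesis om : o < m.

Let w2 i j := wl i j * wl i j.

Let mo : m != o. Proof. by have /andP[] := ord_neq om. Qed.
Let om' : o != m. Proof. by rewrite eq_sym. Qed.

(** This is where order 4 is used. *)
Lemma ws2 c i j : i != j -> ws c i j * ws c i j = w2 i j.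
Proof.
move=> ij; case: c => //=; rewrite -[wl j i]/(ws (~~ false) i j) -wsV //=.
have := w4 ij; rewrite -invgM /w2 => /eqP; rewrite !expgS expg0 mulg1 mulgA mulg_eq1.
by move=> /eqP.
Qed.

Lemma ws_w2 c i j k l : i != j -> k != l -> exists c', ws c k l ^ w2 i j = ws c' k l.
Proof.
move=> ij kl; rewrite /w2 conjgM wswJ // wswJ ?(inj_eq perm_inj) // !tpermK.
by eexists.
Qed.

Lemma ws_w2V c i j k l : i != j -> k != l -> exists c', ws c k l ^ (w2 i j)^-1 = ws c' k l.
Proof.
move=> ij kl; rewrite -(@ws2 true) // invgM wsV //= ; exact: ws_w2.
Qed.

(** The square of w_ij becomes the diagonal matrix with entries -1 at i and j,
    and this is the relation between such matrices. It holds because w_mo^2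
    inverts w_oj, while w_oj conjugates w_mo to w_mj. *)
Lemma w2_shift j : j < m -> j != o -> w2 m o = w2 o j * w2 m j.
Proof.
move=> jm jo; have oj : o != j by rewrite eq_sym.
have /andP[jm' mj] := ord_neq jm.
have E : wl m o ^ wl o j = wl m j.
  rewrite -[wl m o]/(ws false m o) wswJ //= tpermL tpermD //.
  by rewrite (negPf mj) (negPf oj).
have F : wl o j ^ (w2 m o)^-1 = (wl o j)^-1.
  apply: (can_inj (conjgK (w2 m o))); rewrite conjgKV conjVg.
  rewrite -[wl o j]/(ws false o j) /w2 conjgM wswJ //=.
  rewrite tpermR eqxx [tperm m o j]tpermD //.
  rewrite -[wl m o]/(ws false m o).
  rewrite (negPf jo) addbF wswJ //= (negPf jo) (negPf mo) tpermL tpermD //.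
  by rewrite addbF -wsV //= invgK.
have -> : w2 m j = w2 m o ^ wl o j by rewrite /w2 conjMg E.
rewrite conjgE [w2 m o * _]conjgCV F.
by rewrite /w2; move: (wl o j) (wl m o) => g h; rewrite -!mulgA !mulVKg.
Qed.

(** One representative for each vector +-e_j with j <= m in the orbit of e_m. *)
Definition coset_rep t :=
  [\/ t = 1, t = w2 m o | exists c (j : 'I_n), j < m /\ t = ws c m j].

Let coset w := exists w' t, [/\ word_in (weyl_letter m) w', coset_rep t & w = w' * t].

Let coset1 t : coset_rep t -> coset t.
Proof. by exists 1, t; split; rewrite ?mul1g //; constructor. Qed.

Let cosetM w g : word_in (weyl_letter m) w -> coset g -> coset (w * g).
Proof.
move=> ww [w' [t [ww' ct ->]]]; exists (w * w'), t; split; rewrite ?mulgA //.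
exact: word_inM.
Qed.

Let word_ws c (i j : 'I_n) : i != j -> i < m -> j < m -> word_in (weyl_letter m) (ws c i j).
Proof. by move=> *; apply/word_in_letter/weyl_letter_ws. Qed.

Let rep_ws c (j : 'I_n) : j < m -> coset_rep (ws c m j).
Proof. by move=> jm; apply: Or33; exists c, j. Qed.

Lemma coset_rep_letter t g : coset_rep t -> weyl_letter m.+1 g -> coset (t * g).
Proof.
move=> ct [k [p [kp km pm ->]]].
have [[{}km {}pm]|[c [q [qm ->]]]] : (k < m /\ p < m) \/
    (exists c (q : 'I_n), q < m /\ wl k p = ws c m q).
  have [km'|mk] := ltnP k m; have [pm'|mp] := ltnP p m; first by left.
  - by right; exists true, k; split=> //=; congr (wl _ _); apply/val_inj => /=; lia.
  - by right; exists false, p; split=> //=; congr (wl _ _); apply/val_inj => /=; lia.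
  - by case/eqP: kp; apply/val_inj => /=; lia.
- have kpW : word_in (weyl_letter m) (wl k p) by apply: (@word_ws false).
  case: ct => [->|->|[c [q [qm ->]]]].
  + by rewrite mul1g -[wl _ _]mulg1; apply: cosetM => //; apply/coset1/Or31.
  + have [c' E] := ws_w2V false mo kp.
    rewrite conjgCV E; apply: cosetM; first exact: word_ws.
    exact/coset1/Or32.
  + have /andP[qm' mq] := ord_neq qm.
    have /andP[km' _] := ord_neq km; have /andP[pm' _] := ord_neq pm.
    have [c' E] := wsJs false c kp mq.
    rewrite conjgC E tpermD //; apply/cosetM => //; apply/coset1/rep_ws.
    by case: tpermP.
- have /andP[qm' mq] := ord_neq qm.
  case: ct => [->|->|[d [p' [pm' ->]]]].
  + by rewrite mul1g; apply/coset1/rep_ws.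
  + have [->|qo] := eqVneq q o.
      rewrite -(ws2 (~~ c) mo) -[_ * ws c m o]mulgA -wsV // mulVg mulg1 wsV //.
      exact/coset1/rep_ws.
    have oq : o != q by rewrite eq_sym.
    rewrite (w2_shift qm qo) -(ws2 (~~ c) mq) -[w2 o q * _ * _]mulgA.
    rewrite -[ws _ _ _ * _ * _]mulgA -wsV // mulVg mulg1 wsV //.
    apply: cosetM; last exact/coset1/rep_ws.
    by rewrite /w2; apply: word_inM; apply: (@word_ws false).
  + have /andP[pm0 mp] := ord_neq pm'.
    have [E|pq] := eqVneq p' q; last first.
      have [c' E] := wsJs (~~ d) c mp mq.
      rewrite conjgCV wsV // E tpermL tpermD // 1?eq_sym //.
      apply: cosetM; last exact/coset1/rep_ws.
      by apply: word_ws.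
    subst p'; have [dc|dc] := eqVneq d (~~ c).
      by rewrite dc -wsV // mulVg; apply/coset1/Or31.
    have -> : d = c by case: d c dc => -[].
    rewrite ws2 //; have [->|qo] := eqVneq q o; first exact/coset1/Or32.
    have oq : o != q by rewrite eq_sym.
    have -> : w2 m q = (wl o q)^-1 * (wl o q)^-1 * w2 m o.
      by rewrite (w2_shift qm qo) /w2; move: (wl o q) (wl m q) => a b; rewrite -!mulgA !mulKg.
    apply: cosetM; last exact/coset1/Or32.
    by rewrite -[wl o q]/(ws false o q) wsV //; apply: word_inM; apply: word_ws.
Qed.

Lemma coset_repP w : word_in (weyl_letter m.+1) w -> coset w.
Proof.
elim=> [|w' l _ [u [t [uW ct ->]]] lW]; first exact/coset1/Or31.
by rewrite -mulgA; apply: cosetM => //; apply: coset_rep_letter.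
Qed.

(** Among the coset representatives only 1 fixes e_m. *)
Lemma weyl_stabilizer w : word_in (weyl_letter m.+1) w -> vec w = vm ->
  word_in (weyl_letter m) w.
Proof.
move=> /coset_repP [u [t [uW ct ->]]].
have uv : vec u = vm.
  elim: uW => [|u' l _ IH [i [j [ij im jm ->]]]]; first by rewrite /vec rho1 mulmx1.
  have /andP[im' _] := ord_neq im; have /andP[jm' _] := ord_neq jm.
  rewrite /vec rhoM mulmxA -/(vec u') IH; apply/rowP => k; rewrite rho_wlE // !vmE.
  rewrite (negPf im') (negPf jm').
  have [->|_] := eqVneq k j; first by rewrite (negPf jm').
  by have [->|_] := eqVneq k i; rewrite ?(negPf im').
rewrite /vec rhoM mulmxA -/(vec u) uv => transv; move/rowP: transv.
case: ct => [->|->|[c [j [jm ->]]]]; first by rewrite mulg1.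
- move=> /(_ m); rewrite rhoM mulmxA !rho_wlE // !vmE eqxx (negPf mo) ?(negPf om') /=.
  by rewrite ?eqxx.
- have /andP[jm' mj] := ord_neq jm.
  by move=> /(_ j); case: c => /=; rewrite rho_wlE // !vmE !eqxx (negPf jm').
Qed.
End Coset.

(** ** The letters that fix a basis vector *)
Let cm : 'cV[int]_n := delta_mx m 0%R.

Lemma elem_mulE e i j (c : 'cV[int]_n) l :
  (elem_mx e i j *m c)%R l 0%R = (if l == i then c l 0 + negif e (c j 0) else c l 0)%R.
Proof.
rewrite /elem_mx mulmxDl mul1mx -scalemxAl !mxE (bigD1 j) //= big1 => [|k kj].
  by rewrite mxE eqxx addr0 andbT; case: (l == i); case: e => /=; lia.
by rewrite mxE (negPf kj) andbF mul0r.
Qed.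

Lemma cmE l : cm l 0%R = (l == m)%:R%R.
Proof. by rewrite /cm mxE eqxx andbT. Qed.

Lemma x_letter_fix g : word_in (x_letter m) g -> (rho g *m cm = cm)%R.
Proof.
elim=> [|g' l _ IH [e [i [j [ij im jm ->]]]]]; first by rewrite rho1 mul1mx.
have /andP[jm' _] := ord_neq jm.
rewrite rhoM -mulmxA -[RHS]IH; congr (_ *m _)%R; apply/colP => k.
rewrite rho_xs // elem_mulE !cmE (negPf jm').
by case: ifP; case: e => //=; rewrite ?oppr0 addr0.
Qed.

Definition unip_letter (k : nat) (g : G) :=
  exists e i, [/\ i < k, i < m & g = xs e i m].

(** The x_im generate a subgroup that the letters with indices below m
    normalize. *)
Lemma stab_letter_split p : word_in stab_letter p ->
  exists g u, [/\ word_in (x_letter m) g, word_in (unip_letter m) u & p = g * u].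
Proof.
elim=> [|p' l _ [g [u [xg uu ->]]] [e [i [j [ij im jm i'm ->]]]]].
  by exists 1, 1; rewrite mulg1; split=> //; constructor.
have {}im : i < m by rewrite ltn_neqAle -ltnS im andbT.
have [E|j'm] := eqVneq j m.
  subst j; exists g, (u * xs e i m); rewrite mulgA; split=> //.
  by apply: word_inMr => //; exists e, i.
have {}jm : j < m by rewrite ltn_neqAle -ltnS jm andbT.
exists (g * xs e i j), (u ^ xs e i j); split.
- by apply: word_inMr => //; exists e, i, j.
- apply: word_inJ uu => _ [d [k [km _ ->]]].
  have /andP[km' _] := ord_neq km.
  have [->|kj] := eqVneq k j.
    rewrite xsJl //; apply: word_inM; apply: word_in_letter.
      by exists d, j.
    by eexists; exists i.
  rewrite conjg_commute; first by apply: word_in_letter; exists d, k.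
  by apply: xs_commute => //; rewrite eq_sym.
- by rewrite -!mulgA -conjgC.
Qed.

Lemma unip_fix (k : nat) u (c : 'cV[int]_n) (l : 'I_n) : word_in (unip_letter k) u -> k <= l ->
  (rho u *m c)%R l 0%R = c l 0%R.
Proof.
move=> Uu kl; elim: Uu c => [|u' g _ IH [e [i [ik im ->]]]] c; first by rewrite rho1 mul1mx.
have /andP[im' _] := ord_neq im.
rewrite rhoM -mulmxA IH // rho_xs // elem_mulE.
by have /andP[_ /negPf->] := ord_neq (leq_trans ik kl).
Qed.

(** The exponent of x_im in u is entry i of the last column of the matrix of u.
    The generators are removed one at a time, from the largest index down. *)
Lemma unip_faithful (k : nat) u :
  k <= m -> word_in (unip_letter k) u -> (rho u *m cm = cm)%R -> u = 1.
Proof.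
elim: k u => [|k IH] u km Uu; first by case: Uu => // ? ? _ [? [? []]].
pose ki : 'I_n := Ordinal (leq_trans km (ltnW (ltn_ord m))).
have kim : ki < m by [].
have /andP[km' mk] := ord_neq kim.
pose X := x ki m.
(* The exponent of X is a - b; two natural numbers are easier to update. *)
have [u' [a [b [Uu' ->]]]] : exists u' a b,
    word_in (unip_letter k) u' /\ u = u' * (X ^+ a * X ^- b).
  elim: Uu => [|u' l _ [v [a [b [Uv ->]]]] [e [i [ik im ->]]]].
    by exists 1, 0%N, 0%N; rewrite !expg0 invg1 !mulg1; split => //; constructor.
  have cX : commute X (X ^+ b) by exact/commuteX/commute_refl.
  have [E|ik'] := eqVneq (i : nat) k.
    have -> : i = ki by apply: val_inj.
    case: e => /=.
      exists v, a, b.+1; split=> //; by rewrite -!mulgA -invgM -expgS.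
    exists v, a.+1, b; split=> //.
    rewrite expgSr -!mulgA; congr (_ * (_ * _)).
    exact/commute_sym/commuteV.
  have /andP[im' _] := ord_neq im.
  exists (v * xs e i m), a, b; split.
    by apply: word_inMr => //; exists e, i; split=> //; rewrite ltn_neqAle ik' -ltnS.
  have c : commute X (xs e i m).
    rewrite -[X]/(xs false ki m); apply: xs_commute => //.
    by rewrite eq_sym.
  have cb : commute (xs e i m) (X ^+ a * X ^- b).
    by apply: commuteM; [|apply: commuteV]; apply: commuteX; apply: commute_sym.
  by rewrite -[LHS]mulgA -cb mulgA.
pose cz (z : int) : 'cV[int]_n := (cm + z *: delta_mx ki 0)%R.
have czE z l : cz z l 0%R = ((l == m)%:R + z * (l == ki)%:R)%R.
  by rewrite /cz mxE cmE !mxE eqxx andbT.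
have rX z : (rho X *m cz z = cz (z + 1))%R.
  rewrite rho_x //; apply/colP => l; rewrite elem_mulE !czE eqxx (negPf mk) /=.
  by case: (l == ki) => /=; lia.
have rXa r z : (rho (X ^+ r) *m cz z = cz (z + Posz r))%R.
  elim: r z => [|r IHr] z; first by rewrite expg0 rho1 mul1mx addr0.
  by rewrite expgSr rhoM -mulmxA rX IHr -addrA; congr cz; lia.
have rXb r z : (rho (X ^- r) *m cz z = cz (z - Posz r))%R.
  have := rXa r (z - Posz r)%R; rewrite subrK => <-.
  by rewrite mulmxA -rhoM mulVg rho1 mul1mx.
have cz0 : cm = cz 0%R by rewrite /cz scale0r addr0.
rewrite rhoM -mulmxA cz0 rhoM -mulmxA rXb rXa add0r addrC.
move=> E; have ab : a = b.
  move/colP/(_ ki): E; rewrite (unip_fix _ Uu') // !czE eqxx mul0r addr0 mulr1.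
  by rewrite (negPf km') add0r => /eqP; rewrite subr_eq0 eqz_nat => /eqP.
move: E; rewrite ab subrr mulgV mulg1 -cz0 => E.
by apply: IH => //; apply: ltnW.
Qed.
End Row.

Lemma weyl_letter_words M g : weyl_letter M g -> word_in (x_letter M) g.
Proof.
case=> i [j [ij im jm ->]]; have ji : j != i by rewrite eq_sym.
rewrite /wl -[(x j i)^-1]/(xs true j i) -[x i j]/(xs false i j).
apply: word_inM; last by apply: word_in_letter; exists false, i, j.
by apply: word_inM; apply: word_in_letter; [exists false, i, j | exists true, j, i].
Qed.

Lemma faithful_step (m : 'I_n) g :
  word_in (x_letter m.+1) g -> rho g = 1%:M%R -> word_in (x_letter m) g.
Proof.
move=> xg g1; have [m0|m_gt0] := posnP m.
  suff -> : g = 1 by constructor.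
  case: xg {g1} => // g' l _ [e [i [j [ij im jm _]]]]; case/eqP: ij; apply/val_inj => /=.
  by move: im jm; rewrite m0; lia.
pose o : 'I_n := Ordinal (leq_trans m_gt0 (ltnW (ltn_ord m))).
have [|p [w [Pp Ww E]]] := climb_norm1 (x_letter_climb xg).
  by rewrite g1 mulmx1 l1_vm.
pose v : 'rV[int]_n := delta_mx 0%R m.
have wv : (v *m rho w = v)%R.
  by rewrite -{1}[v](stab_letter_fix Pp) -/v -mulmxA -rhoM -E g1 mulmx1.
have om : o < m by [].
have {}Ww := weyl_stabilizer om Ww wv.
have Pw : word_in (stab_letter m) w.
  apply: word_in_sub Ww => l /weyl_letter_words; apply: word_in_sub.
  move=> l' [e [i [j [ij im jm ->]]]]; apply: word_in_letter; exists e, i, j.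
  have /andP[im' _] := ord_neq im.
  by split=> //; apply: ltnW.
have /stab_letter_split [g' [u [xg' Uu E']]] : word_in (stab_letter m) g.
  by rewrite E; apply: word_inM.
suff u1 : u = 1 by rewrite E' u1 mulg1.
apply: (unip_faithful (leqnn m) Uu).
have -> : u = g'^-1 * g by rewrite E' mulKg.
by rewrite rhoM g1 mulmx1; apply/x_letter_fix/word_inV => // l; apply: x_letterV.
Qed.

Theorem steinberg_faithful g : word_in (x_letter n) g -> rho g = 1%:M%R -> g = 1.
Proof.
move=> xg g1; suff H M : M <= n -> word_in (x_letter (n - M)) g.
  have := H n (leqnn n); rewrite subnn; case=> // g' l _ [e [i [j []]]] //.
elim: M => [|M IH] Mn; first by rewrite subn0.
have lt : n - M.+1 < n by lia.
apply: (@faithful_step (Ordinal lt)) => //=.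
by rewrite subnSK //; apply: IH; apply: ltnW.
Qed.

End Descent.
End Steinberg.

(** * The words tau in SL_n(Z) *)
Section Matrices.
Variable n : nat.
Implicit Types (i j k l r : nat) (c z : int) (A B : 'M[int]_n) (X Y g : SL n).

(** Indices start at 1, as they do in the words; the vector is 0 outside the
    range. *)
Definition basis_row k : 'rV[int]_n := (\row_l (l.+1 == k)%:R)%R.

Definition transv c i j : 'M[int]_n := (1%:M + c *: mx_unit n i j)%R.

Lemma basis_row_ext A B :
  (forall k, 1 <= k <= n -> (basis_row k *m A = basis_row k *m B)%R) -> A = B.
Proof.
move=> h; apply/row_matrixP => i; rewrite !rowE.
suff -> : delta_mx 0%R i = basis_row i.+1 by apply: h; rewrite ltn_ord.
by apply/rowP => l; rewrite !mxE eqxx eqSS.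
Qed.

Lemma basis_row_transv k c i j : 1 <= k <= n ->
  (basis_row k *m transv c i j = basis_row k + (c *+ (k == i)) *: basis_row j)%R.
Proof.
case: k => // k kn; rewrite mulmxDr mulmx1 -scalemxAr; congr (_ + _)%R.
apply/rowP => l; rewrite !mxE (bigD1 (Ordinal kn)) //= big1 => [|p pk].
  by rewrite !mxE /= eqxx mul1r addr0; case: eqP; case: eqP => //=; lia.
rewrite !mxE eqSS; have -> : (p == k :> nat) = false; last by rewrite mul0r.
by apply/negbTE; apply: contra pk => /eqP E; apply/eqP/val_inj.
Qed.

Lemma basis_row_a k : 1 <= k <= n ->
  (basis_row k *m a_mx n = if (k < n)%N then basis_row k.+1 else (-1) ^+ n.-1 *: basis_row 1)%R.
Proof.
case: k => // k kn; apply/rowP => l.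
rewrite mxE (bigD1 (Ordinal kn)) //= big1 => [|p pk]; last first.
  rewrite !mxE eqSS; have -> : (p == k :> nat) = false; last by rewrite mul0r.
  by apply/negbTE; apply: contra pk => /eqP E; apply/eqP/val_inj.
rewrite a_mxE !mxE /= eqxx mul1r addr0.
case: ltnP => kn'; rewrite !mxE !eqSS.
  by rewrite (ltn_eqF kn') mulr0 addr0 eq_sym.
have -> : k.+1 = n by lia.
by rewrite eqxx (gtn_eqF (ltn_ord l)) add0r.
Qed.

Lemma SL_eq X Y : SL_mx X = SL_mx Y -> X = Y.
Proof. exact: val_inj. Qed.

Lemma SL_mxM X Y : SL_mx (X * Y) = (SL_mx X *m SL_mx Y)%R.
Proof. by []. Qed.

Lemma SL_mxVK X (N : 'M[int]_n) : (SL_mx (X^-1)%g *m (SL_mx X *m N) = N)%R.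
Proof. by rewrite mulmxA -SL_mxM mulVg mul1mx. Qed.

Lemma SL_conj_mx g X N :
  (SL_mx X *m SL_mx g = SL_mx g *m N)%R -> SL_mx (g^-1 * X * g) = N.
Proof. by rewrite -mulgA !SL_mxM => ->; rewrite SL_mxVK. Qed.

(** Inverses in SL_n(Z) are adjugates, so commutators are best recognized by
    multiplying out. *)
Lemma SL_comm_mx X Y N :
  (SL_mx X *m SL_mx Y = SL_mx Y *m SL_mx X *m N)%R -> SL_mx [~ X, Y] = N.
Proof.
rewrite commgEl conjgE mulgA -invgM -!SL_mxM => E.
by rewrite SL_mxM E SL_mxVK.
Qed.

Lemma transv_inv c i j : i != j -> 1 <= j <= n -> (transv c i j *m transv (- c) i j = 1%:M)%R.
Proof.
move=> ij jn; apply: basis_row_ext => k kn.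
rewrite mulmx1 mulmxA basis_row_transv // mulmxDl -scalemxAl !basis_row_transv //.
rewrite [j == i]eq_sym (negPf ij) mulr0n scale0r addr0.
by rewrite mulNrn scaleNr -addrA addNr addr0.
Qed.

Lemma SL_inv_transv X c i j : i != j -> 1 <= j <= n ->
  SL_mx X = transv c i j -> SL_mx X^-1 = transv (- c)%R i j.
Proof.
by move=> ij jn E; rewrite -[RHS](SL_mxVK X) E transv_inv // mulmx1.
Qed.

Lemma SL_comm_transv X Y i j k : 1 <= j <= n -> 1 <= k <= n ->
  i != j -> j != k -> i != k ->
  SL_mx X = transv 1 i j -> SL_mx Y = transv 1 j k -> SL_mx [~ X, Y] = transv 1 i k.
Proof.
move=> jn kn ij jk ik EX EY; apply: SL_comm_mx; rewrite EX EY.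
apply: basis_row_ext => l ln; rewrite !mulmxA !basis_row_transv //.
rewrite !mulmxDl -!scalemxAl !basis_row_transv //.
rewrite !mulmxDl -!scalemxAl !basis_row_transv //.
have [ji ki kj] : [/\ (j == i) = false, (k == i) = false & (k == j) = false] by split; lia.
rewrite ?ji ?ki ?kj ?eqxx ?(negPf ij) ?(negPf jk) ?(negPf ik) !mulr0n !mulr1n !scale0r !addr0.
by case: (l == i); case: (l == j); apply/rowP => q; rewrite !mxE ?mulr0n ?mulr1n; lia.
Qed.

Lemma SL_commute_transv X Y i j k l : 1 <= j <= n -> 1 <= l <= n ->
  i != l -> j != k ->
  SL_mx X = transv 1 i j -> SL_mx Y = transv 1 k l -> [~ X, Y] = 1.
Proof.
move=> jn ln il jk EX EY; apply: SL_eq; apply: SL_comm_mx; rewrite EX EY mulmx1.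
apply: basis_row_ext => m mn; rewrite !mulmxA !basis_row_transv //.
rewrite !mulmxDl -!scalemxAl !basis_row_transv //.
rewrite (negPf jk) [l == i]eq_sym (negPf il) !mulr0n !scale0r !addr0.
by rewrite addrAC.
Qed.

Hypothesis n_gt2 : 2 < n.
Let a := a_SL n.
Let b := b_SL n.

(** Conjugation by a_n shifts both indices by one. *)
Lemma tau_subdiag_mx r : 0 < r < n -> SL_mx (tau_subdiag a b r) = transv 1 r.+1 r.
Proof.
case: r => // r; elim: r => [|r IH] rn.
  have -> : tau_subdiag a b 1 = b by rewrite /tau_subdiag !expg0 invg1 mul1g mulg1.
  by rewrite /= /b_mx /transv scale1r.
have -> : tau_subdiag a b r.+2 = a^-1 * tau_subdiag a b r.+1 * a.
  by rewrite /tau_subdiag /= expgSr invgM !mulgA.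
apply: SL_conj_mx; rewrite IH /=; last by lia.
apply: basis_row_ext => k kn; rewrite !mulmxA basis_row_transv // basis_row_a //.
rewrite mulmxDl -scalemxAl !basis_row_a //; last by lia.
have -> : r.+1 < n by lia.
case: ltnP => kn'; rewrite -?scalemxAl basis_row_transv //; try lia.
have -> : (k == r.+2) = false by lia.
by rewrite /= !mulr0n !scale0r !addr0.
Qed.

(** The last shift wraps around and picks up the corner entry of a_n as a sign,
    which the exponent in the definition of tau_1n cancels. *)
Lemma tau_1n_mx : SL_mx (tau_1n n a b) = transv 1 1 n.
Proof.
have E : SL_mx (a ^- n.-1 * b * a ^+ n.-1) = transv ((-1) ^+ n.-1)%R 1 n.
  have n1 : n.-1 = n.-2.+1 by lia.
  have -> : a ^- n.-1 * b * a ^+ n.-1 = a^-1 * tau_subdiag a b n.-1 * a.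
    by rewrite /tau_subdiag n1 expgSr invgM !mulgA.
  apply: SL_conj_mx; rewrite tau_subdiag_mx; last lia.
  apply: basis_row_ext => k kn; rewrite !mulmxA basis_row_transv // basis_row_a //.
  rewrite mulmxDl -scalemxAl !basis_row_a //; last by lia.
  have -> : n.-1 < n by lia.
  have -> : n.-1.+1 = n by lia.
  case: ltnP => kn'; rewrite -?scalemxAl basis_row_transv //; try lia.
    have -> : (k == n) = false by lia.
    have -> : (k.+1 == 1)%N = false by lia.
    by rewrite !mulr0n !scale0r !addr0.
  have -> : (k == n) by lia.
  by rewrite eqxx !mulr1n scalerDr scalerA -expr2 sqrr_sign.
rewrite /tau_1n; case: ifP => on.
  by rewrite E -signr_odd; have -> : odd n.-1 = false by lia.
rewrite (SL_inv_transv _ _ E); try lia.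
by rewrite -signr_odd; have -> : odd n.-1 by lia; rewrite opprK.
Qed.

Lemma tau_lower_mx d j : 0 < d -> 0 < j -> d + j <= n ->
  SL_mx (tau_lower a b d j) = transv 1 (d + j) j.
Proof.
elim: d j => // -[|d] IH j _ j0 dj; first by apply: tau_subdiag_mx; lia.
rewrite -[tau_lower _ _ _ _]/([~ tau_lower a b d.+1 j.+1, tau_subdiag a b j]).
apply: (@SL_comm_transv _ _ _ j.+1); try lia.
  by rewrite IH ?addSnnS //; lia.
by apply: tau_subdiag_mx; lia.
Qed.

Lemma tau_lastcol_mx i : 0 < i < n -> SL_mx (tau_lastcol n a b i) = transv 1 i n.
Proof.
move=> /andP[i0 iltn]; rewrite /tau_lastcol; case: eqP => [->|i1]; first exact: tau_1n_mx.
apply: (@SL_comm_transv _ _ _ 1); try lia; last exact: tau_1n_mx.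
by rewrite tau_lower_mx; try lia; congr transv; lia.
Qed.

Lemma tau_mx i j : 1 <= i <= n -> 1 <= j <= n -> i != j ->
  SL_mx (tau n a b i j) = transv 1 i j.
Proof.
move=> iin jn ij; rewrite /tau; case: ltnP => ji.
  by rewrite tau_lower_mx; try lia; congr transv; lia.
case: eqP => [->|jn']; first by apply: tau_lastcol_mx; lia.
apply: (@SL_comm_transv _ _ _ n); try lia; first by apply: tau_lastcol_mx; lia.
by rewrite tau_lower_mx; try lia; congr transv; lia.
Qed.

Lemma basis_row_weyl i k : 1 <= i < n -> 1 <= k <= n ->
  (basis_row k *m SL_mx (weyl n a b i)
   = if k == i then basis_row i.+1 else if k == i.+1 then - basis_row i else basis_row k)%R.
Proof.
move=> iin kn; rewrite /weyl !SL_mxM.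
have i1 : i != i.+1 by lia.
have E1 : SL_mx (tau n a b i i.+1) = transv 1 i i.+1 by apply: tau_mx; lia.
have E2 : SL_mx (tau n a b i.+1 i) = transv 1 i.+1 i by apply: tau_mx; lia.
have {}E2 : SL_mx (tau n a b i.+1 i)^-1 = transv (-1) i.+1 i.
  by apply: SL_inv_transv E2; lia.
rewrite E1 E2 !mulmxA basis_row_transv // !mulmxDl -!scalemxAl !basis_row_transv //; try lia.
rewrite !mulmxDl -!scalemxAl !basis_row_transv //; try lia.
have i2 : (i.+1 == i) = false by lia.
rewrite ?eqxx ?(negPf i1) ?i2.
have [->|ki] := eqVneq k i.
  by rewrite ?(negPf i1); apply/rowP => q; rewrite !mxE ?mulr0n ?mulr1n; lia.
have [->|ki1] := eqVneq k i.+1.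
  by apply/rowP => q; rewrite !mxE ?mulr0n ?mulr1n; lia.
by rewrite !mulr0n !scale0r !addr0.
Qed.

(** Each factor w_i,i+1 moves e_i to e_(i+1), which the later factors fix, while
    e_(m+1) is carried down to e_1 and changes sign at every step. *)
Lemma basis_row_weyl_prod m k : m < n -> 1 <= k <= n ->
  (basis_row k *m SL_mx (\prod_(i <- rev (iota 1 m)) weyl n a b i)%g
   = if (k <= m)%N then basis_row k.+1
     else if k == m.+1 then (-1) ^+ m *: basis_row 1 else basis_row k)%R.
Proof.
elim: m k => [|m IH] k mn kn.
  rewrite big_nil mulmx1; case: k kn => // k _; rewrite /= eqSS.
  by case: eqP => [->|]; rewrite ?scale1r.
rewrite -[m.+1]addn1 iotaD rev_cat big_cat /= big_seq1 SL_mxM mulmxA basis_row_weyl //.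
rewrite add1n addn1.
have [->|km1] := eqVneq k m.+1.
  rewrite leqnn IH; try lia.
  have -> : (m.+2 <= m)%N = false by lia.
  by have -> : (m.+2 == m.+1) = false by lia.
have [->|km2] := eqVneq k m.+2.
  rewrite ltnn mulNmx IH; try lia.
  by rewrite ltnn eqxx exprS mulN1r scaleNr.
rewrite IH //; try lia.
by rewrite (negPf km1); have -> : (k <= m.+1)%N = (k <= m)%N by lia.
Qed.

Lemma SL_relations uv : relations n a b uv -> uv.1 = uv.2.
Proof.
case=> [i j k l ir jr kr lr /eqP ij /eqP kl _ /eqP il /eqP jk
      |i j k ir jr kr /eqP ij /eqP jk /eqP ik||] /=.
- by apply: (@SL_commute_transv _ _ i j k l) => //; apply: tau_mx.
- apply: SL_eq; rewrite tau_mx //.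
  by apply: (@SL_comm_transv _ _ i j k) => //; apply: tau_mx.
- pose W := SL_mx (weyl n a b 1).
  have W2 k : 1 <= k <= n ->
      (basis_row k *m W *m W = if (k == 1%N) || (k == 2) then - basis_row k else basis_row k)%R.
    move=> kn; rewrite /W basis_row_weyl //; last lia.
    have [->|k1] := eqVneq k 1%N; first by rewrite basis_row_weyl //; lia.
    have [->|k2] := eqVneq k 2; first by rewrite mulNmx basis_row_weyl //; lia.
    by rewrite basis_row_weyl ?(negPf k1) ?(negPf k2) //; lia.
  have W4 : SL_mx (weyl n a b 1 ^+ 4) = (W *m (W *m (W *m W)))%R by [].
  clearbody W; apply: SL_eq; apply: basis_row_ext => k kn; rewrite W4 !mulmxA.
  by rewrite W2 // mulmx1; case: ifP => E; rewrite ?mulNmx W2 // E ?opprK.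
- apply: SL_eq; apply: basis_row_ext => k kn; rewrite basis_row_weyl_prod //; last lia.
  rewrite basis_row_a //; have -> : (k <= n.-1)%N = (k < n)%N by lia.
  by case: ltnP => // nk; have -> : (k == n.-1.+1) by lia.
Qed.

Lemma basis_row_apow m k : 0 < k -> k + m <= n ->
  (basis_row k *m SL_mx (a ^+ m)%g = basis_row (k + m))%R.
Proof.
elim: m k => [|m IH] k k0 km; first by rewrite expg0 mulmx1 addn0.
rewrite expgS SL_mxM mulmxA basis_row_a; last lia.
have -> : k < n by lia.
by rewrite IH ?addSnnS //; lia.
Qed.

(** Each basis vector passes the corner of a_n exactly once in n steps. *)
Lemma a_pow_n : SL_mx (a ^+ n) = ((-1) ^+ n.-1)%:M%R.
Proof.
apply: basis_row_ext => k kn; rewrite mul_mx_scalar.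
have -> : a ^+ n = a ^+ (n - k) * (a ^+ 1 * a ^+ k.-1).
  by rewrite -!expgnDr; congr (_ ^+ _); lia.
rewrite expg1 !SL_mxM !mulmxA basis_row_apow; try lia.
have -> : (k + (n - k))%N = n by lia.
rewrite basis_row_a ?ltnn ?leqnn; try lia.
rewrite -scalemxAl basis_row_apow; try lia.
by congr (_ *: basis_row _)%R; lia.
Qed.

End Matrices.

(** * Homomorphisms out of free and presented groups *)
Section FreeLift.
Variables (X : choiceType) (H : groupType) (f : X -> H).

Definition lift_letter (l : X * bool) : H := if l.2 then (f l.1)^-1 else f l.1.

Definition lift_word (w : seq (X * bool)) : H :=
  foldr (fun l h => lift_letter l * h) 1 w.

Definition free_lift (u : free_group X) : H := lift_word u.

Lemma lift_letterV l : lift_letter (inv_letter l) = (lift_letter l)^-1.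
Proof. by case: l => y [] //=; rewrite /lift_letter /= invgK. Qed.

Lemma lift_push l w : lift_word (push_letter l w) = lift_letter l * lift_word w.
Proof.
case: w => [|m w] //=; case: eqP => [->|] //=.
by rewrite lift_letterV mulVKg.
Qed.

Lemma free_lift_is_morphism : monoid.monoid_morphism free_lift.
Proof.
split=> // u v; rewrite /free_lift /=; elim: (word_of u) => [|l w IH] /=.
  by rewrite mul1g.
by rewrite lift_push IH mulgA.
Qed.

HB.instance Definition _ :=
  isUMagmaMorphism.Build (free_group X) H free_lift free_lift_is_morphism.

Lemma free_lift_gen y : free_lift (free_gen y) = f y.
Proof. by rewrite /free_lift /= mulg1. Qed.

End FreeLift.

Section WordsMorphism.
Variables (G H : groupType) (f : UMagmaMorphism.type G H) (n : nat) (a b : G).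

Lemma tau_morph i j : f (tau n a b i j) = tau n (f a) (f b) i j.
Proof.
have E r : f (tau_subdiag a b r) = tau_subdiag (f a) (f b) r.
  by rewrite /tau_subdiag !gmulfM gmulfV !gmulfXn.
have L d k : f (tau_lower a b d k) = tau_lower (f a) (f b) d k.
  elim: d k => [|[|d] IH] k; [exact: gmulf1|exact: E|].
  rewrite -[tau_lower _ _ _ _]/([~ tau_lower a b d.+1 k.+1, tau_subdiag a b k]).
  by rewrite gmulfR IH E.
have T : f (tau_1n n a b) = tau_1n n (f a) (f b).
  by rewrite /tau_1n; case: ifP => _; rewrite ?gmulfV !gmulfM gmulfV !gmulfXn.
have C k : f (tau_lastcol n a b k) = tau_lastcol n (f a) (f b) k.
  by rewrite /tau_lastcol; case: ifP => _; rewrite ?gmulfR ?L T.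
rewrite /tau; case: ifP => _; first exact: L.
by case: ifP => _; rewrite ?gmulfR ?L C.
Qed.

Lemma weyl_morph i : f (weyl n a b i) = weyl n (f a) (f b) i.
Proof. by rewrite /weyl !gmulfM gmulfV !tau_morph. Qed.

Lemma relations_morph r :
  relations n a b r -> relations n (f a) (f b) (f r.1, f r.2).
Proof.
case=> [i j k l ? ? ? ? ? ? ? ? ?|i j k ? ? ? ? ? ?||] /=.
- by rewrite gmulf1 gmulfR !tau_morph; apply: rel_commute.
- by rewrite gmulfR !tau_morph; apply: rel_steinberg.
- by rewrite gmulf1 gmulfXn weyl_morph; apply: rel_weyl4.
- rewrite gmulf_prod (eq_bigr (weyl n (f a) (f b))); last by move=> i _; apply: weyl_morph.
  exact: rel_a.
Qed.
End WordsMorphism.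

Section QuotientFacts.
Variables (G : groupType) (N : normal_subgroup G).

Lemma quot_map_eq1 x : N x <-> quot_map N x = 1.
Proof.
rewrite -[1]/(quot_map N 1); split=> [Nx|/esym/quot_mapP]; last by rewrite invg1 mul1g.
by apply/esym/quot_mapP; rewrite invg1 mul1g.
Qed.

Lemma quot_map_surj (u : quot N) : exists x, quot_map N x = u.
Proof. by exists (repr u); apply: reprK. Qed.
End QuotientFacts.

Lemma normal_closure_sub (G : groupType) (A : set G) x :
  A x -> normal_closure A x.
Proof. by move=> Ax N [_]; apply. Qed.

Lemma normal_closureW (G : groupType) (A B : set G) x :
  (A `<=` B)%classic -> normal_closure A x -> normal_closure B x.
Proof. by move=> AB Ax N [nN BN]; apply: Ax; split=> // y /AB /BN. Qed.

Lemma normal_closure_morph (X : choiceType) (H : groupType)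
    (f : UMagmaMorphism.type (free_group X) H) (R : set (free_group X * free_group X)) u :
  (forall r, R r -> f r.1 = f r.2) -> normal_closure (relators R) u -> f u = 1.
Proof.
move=> fR /(_ [set v | f v = 1]%classic); apply; split; last first.
  by move=> _ [r Rr <-] /=; rewrite gmulfF (fR _ Rr) mulgV.
split=> /= [|x y fx fy|x g fx]; first exact: gmulf1.
  by rewrite gmulfF fx fy divg1.
by rewrite gmulfJ fx conj1g.
Qed.

(** * The kernel of the evaluation in SL_n(Z) *)
Section Kernel.
Variable n : nat.
Hypothesis n_gt2 : 2 < n.

Definition eval_SL : free_group bool -> SL n :=
  free_lift (fun g : bool => if g then b_SL n else a_SL n).

HB.instance Definition _ := monoid.UMagmaMorphism.copy eval_SL
  (free_lift (fun g : bool => if g then b_SL n else a_SL n)).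

Lemma eval_SL_a : eval_SL word_a = a_SL n. Proof. exact: free_lift_gen. Qed.
Lemma eval_SL_b : eval_SL word_b = b_SL n. Proof. exact: free_lift_gen. Qed.

Lemma eval_SL_relations r : Rn n r -> eval_SL r.1 = eval_SL r.2.
Proof.
move=> Rr.
have : relations n (eval_SL word_a) (eval_SL word_b) (eval_SL r.1, eval_SL r.2).
  exact: relations_morph.
by rewrite eval_SL_a eval_SL_b => /(SL_relations n_gt2).
Qed.

Local Notation P := (presented (Rn n)).
Local Notation q := (quot_map (normal_closure (relators (Rn n)))).

Let q1 : q 1 = 1. Proof. exact: gmulf1. Qed.

Let q_relations r : Rn n r -> q r.1 = q r.2.
Proof.
move=> Rr; have /quot_map_eq1 : normal_closure (relators (Rn n)) (r.1 / r.2).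
  by apply: normal_closure_sub; exists r.
by rewrite gmulfF => /divg1_eq.
Qed.

Let x (i j : 'I_n) : P := q (tau n word_a word_b i.+1 j.+1).

Let ord_in_range (i : 'I_n) : in_range n i.+1. Proof. exact: ltn_ord. Qed.

Let x_commute i j k l : i != j -> k != l -> i != l -> j != k -> commute (x i j) (x k l).
Proof.
move=> ij kl il jk; have [E|ne] := eqVneq (i, j) (k, l).
  by case: E => -> ->; apply: commute_refl.
apply/commgP/eqP; rewrite -gmulfR.
rewrite -q1; apply: (q_relations (r := (_, 1))).
apply: rel_commute => //; try by move/succn_inj/val_inj/eqP; apply/negP.
by case=> /val_inj E /val_inj F; move: ne; rewrite E F eqxx.
Qed.

Let x_comm i j k : i != j -> j != k -> i != k -> [~ x i j, x j k] = x i k.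
Proof.
move=> ij jk ik; rewrite -gmulfR.
apply: (q_relations (r := ([~ _, _], _))).
by apply: rel_steinberg => //; move/succn_inj/val_inj/eqP; apply/negP.
Qed.

Let i0 : 'I_n := Ordinal (ltnW (ltnW n_gt2)).
Let i1 : 'I_n := Ordinal (ltnW n_gt2).

Let q_weyl (i j : 'I_n) : i.+1 = j :> nat -> q (weyl n word_a word_b j) = wl x i j.
Proof.
by move=> ij; rewrite /weyl !gmulfM gmulfV /wl /x ij.
Qed.

Let w4 i j : i != j -> wl x i j ^+ 4 = 1.
Proof.
apply: (w4_all n_gt2 x_commute x_comm (i0 := i0) (j0 := i1)) => //.
rewrite -q_weyl // -gmulfXn.
rewrite -q1; exact: (q_relations (rel_weyl4 _ _ _)).
Qed.

(* Representatives suffice to define the induced map, since evaluation kills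
   the relators. *)
Let rho (g : P) : 'M[int]_n := SL_mx (eval_SL (repr g)).

Let rho_q u : rho (q u) = SL_mx (eval_SL u).
Proof.
congr SL_mx; have /esym/quot_mapP : q (repr (q u)) = q u by exact: reprK.
move=> /(normal_closure_morph (f := eval_SL) eval_SL_relations); rewrite gmulfM gmulfV.
by move=> E; apply: (mulgI (eval_SL u)^-1); rewrite mulVg E.
Qed.

Let rho1 : rho 1 = 1%:M%R.
Proof. by rewrite -q1 rho_q gmulf1. Qed.

Let rhoM g h : rho (g * h) = (rho g *m rho h)%R.
Proof.
have [u <-] := quot_map_surj g; have [v <-] := quot_map_surj h.
by rewrite -gmulfM !rho_q gmulfM.
Qed.

Lemma transv_elem (i j : 'I_n) : transv n 1 i.+1 j.+1 = elem_mx false i j.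
Proof. by apply/matrixP => k l; rewrite !mxE !eqSS. Qed.

Lemma SL_tau_elem (i j : 'I_n) : i != j ->
  SL_mx (tau n (a_SL n) (b_SL n) i.+1 j.+1) = elem_mx false i j.
Proof. by move=> ij; rewrite tau_mx ?ltn_ord ?eqSS // transv_elem. Qed.

Let rho_x i j : i != j -> rho (x i j) = elem_mx false i j.
Proof.
move=> ij; rewrite rho_q -SL_tau_elem // -eval_SL_a -eval_SL_b.
by congr SL_mx; apply: tau_morph.
Qed.

Let xn_letter e i j : i != j -> x_letter x n (xs x e i j).
Proof. by move=> ij; exists e, i, j; split. Qed.

(* For the generator a this is the last relation. *)
Let word_gen g : word_in (x_letter x n) (q (free_gen g)).
Proof.
case: g; rewrite -?[free_gen _]/word_b -?[free_gen _]/word_a.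
  have -> : word_b = tau n word_a word_b 2 1.
    by rewrite /tau /= /tau_subdiag /= !expg0 invg1 mul1g mulg1.
  by apply: word_in_letter; apply: (@xn_letter false i1 i0).
rewrite (q_relations (rel_a _ _ _)) /= gmulf_prod.
have : all (fun i => 0 < i < n) (rev (iota 1 n.-1)).
  by rewrite all_rev; apply/allP => i; rewrite mem_iota; move: n_gt2; lia.
elim: (rev _) => [|i s IH] /=; first by rewrite big_nil; constructor.
move=> /andP[/andP[i_gt0 i_n] /IH sW]; rewrite big_cons; apply: word_inM => //.
case: i i_gt0 i_n => // i _ i_n.
have /= -> := q_weyl (i := Ordinal (ltnW i_n)) (j := Ordinal i_n) erefl.
apply: weyl_letter_words; exists (Ordinal (ltnW i_n)), (Ordinal i_n); split=> //=; last exact: ltnW.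
by rewrite -(inj_eq val_inj) /=; lia.
Qed.

Let word_q u : word_in (x_letter x n) (q u).
Proof.
case: u; elim=> [|[g e] w IH] rw /=.
  have -> : FreeGroup rw = 1 by apply: val_inj.
  by rewrite gmulf1; constructor.
have rw' : reduced w := path_sorted rw.
have wg : word_in (x_letter x n) (q (if e then (free_gen g)^-1 else free_gen g)).
  case: e {rw}; rewrite ?gmulfV; last exact: word_gen.
  by apply: word_inV (word_gen g) => l; apply: x_letterV.
suff -> : FreeGroup rw = (if e then (free_gen g)^-1 else free_gen g) * FreeGroup rw'.
  by rewrite gmulfM; apply: word_inM => //; apply: IH.
apply: val_inj => /=; case: e rw {wg} => /= rw;
  by case: w rw {IH rw'} => [|l w] //= /andP[/negPf->].
Qed.

Theorem eval_SL_kernel u : eval_SL u = 1 -> normal_closure (relators (Rn n)) u.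
Proof.
move=> u1; apply/quot_map_eq1.
apply: (steinberg_faithful n_gt2 x_commute x_comm w4 rho1 rhoM rho_x).
  exact: word_q.
by rewrite rho_q u1.
Qed.

End Kernel.

(** * Elementary matrices generate SL_n(Z) *)
Lemma row_elem_mul (n : nat) e (i j l : 'I_n) (M : 'M[int]_n) :
  row l (elem_mx e i j *m M)%R = (row l M + (negif e 1 *+ (l == i)) *: row j M)%R.
Proof.
rewrite /elem_mx mulmxDl mul1mx -scalemxAl; apply/rowP => p.
rewrite !mxE (bigD1 j) //= big1 => [|k kj].
  by rewrite mxE eqxx andbT addr0; case: (l == i); case: e => /=; rewrite ?mulr1n ?mulr0n; lia.
by rewrite mxE (negPf kj) andbF mul0r.
Qed.

Section Generation.
Variable n : nat.
Hypothesis n_gt2 : 2 < n.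
Implicit Types (A B : SL n) (i j k l m : 'I_n) (e : bool).

Lemma SL_row_nonzero A m : exists i, SL_mx A m i != 0%R.
Proof.
have [i h|h] := pickP (fun i => SL_mx A m i != 0%R); first by exists i.
have := SL_det A; rewrite (expand_det_row _ m) big1 // => i _.
by have /negbFE/eqP-> := h i; rewrite mul0r.
Qed.

Lemma SL_row_unit A m i : (forall j, j != i -> SL_mx A m j = 0%R) -> absz (SL_mx A m i) = 1%N.
Proof.
move=> h; have := SL_det A; rewrite (expand_det_row _ m) (bigD1 i) //= big1 => [|j ji].
  rewrite addr0 => /eqP /(congr1 absz); rewrite abszM => /eqP.
  by rewrite muln_eq1 => /andP[/eqP].
by rewrite h // mul0r.
Qed.

Variable S : SL n -> Prop.
Hypothesis S1 : S 1.
Hypothesis SM : forall A B, S A -> S B -> S (A * B).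
Hypothesis SV : forall A, S A -> S A^-1.
Hypothesis S_elem : forall A i j, i != j -> SL_mx A = elem_mx false i j -> S A.

Let E e i j : SL n := xs (fun i j => tau n (a_SL n) (b_SL n) i.+1 j.+1) e i j.

Let E_mx e i j : i != j -> SL_mx (E e i j) = elem_mx e i j.
Proof.
move=> ij; case: e => /=; last exact: SL_tau_elem.
have iN : 1 <= i.+1 <= n by rewrite ltn_ord.
have jN : 1 <= j.+1 <= n by rewrite ltn_ord.
have ijN : i.+1 != j.+1 by rewrite eqSS.
rewrite [LHS](SL_inv_transv ijN jN (tau_mx n_gt2 iN jN ijN)).
by apply/matrixP => k l; rewrite !mxE !eqSS.
Qed.

Let S_E e i j : i != j -> S (E e i j).
Proof.
move=> ij; case: e => /=; last by apply: (S_elem ij); apply: (E_mx false).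
by apply: SV; apply: (S_elem ij); apply: (E_mx false).
Qed.

Let S_mulr A e i j : i != j -> S (A * E e i j) -> S A.
Proof. by move=> ij SA; rewrite -(mulgK (E e i j) A); apply: SM => //; apply/SV/S_E. Qed.

Let S_mull A e i j : i != j -> S (E e i j * A) -> S A.
Proof. by move=> ij SA; rewrite -(mulKg (E e i j) A); apply: SM => //; apply/SV/S_E. Qed.

Let fixed (k : nat) A := forall l, k <= l -> row l (SL_mx A) = delta_mx 0%R l.

Let row_mulr A e i j l : i != j ->
  row l (SL_mx (A * E e i j)) = (row l (SL_mx A) *m elem_mx e i j)%R.
Proof. by move=> ij; rewrite SL_mxM E_mx // row_mul. Qed.

Let fixed_mulr A e i j (k : nat) : i != j -> i < k -> fixed k A -> fixed k (A * E e i j).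
Proof.
move=> ij ik fA l kl; rewrite row_mulr // fA //; apply/rowP => p; rewrite mul_elemE !mxE eqxx /=.
have /andP[/negPf -> _] := ord_neq (leq_trans ik kl).
by case: ifP; case: e => //=; rewrite ?oppr0 addr0.
Qed.

Let row_mull A e i j l : i != j ->
  row l (SL_mx (E e i j * A)) = (row l (SL_mx A) + (negif e 1 *+ (l == i)) *: row j (SL_mx A))%R.
Proof.
by move=> ij; rewrite SL_mxM E_mx // row_elem_mul.
Qed.

Let fixed_mull A e i j (k : nat) : i != j -> i < k -> fixed k A -> fixed k (E e i j * A).
Proof.
move=> ij ik fA l kl; rewrite row_mull // fA //.
by have /andP[_ /negPf ->] := ord_neq (leq_trans ik kl); rewrite mulr0n scale0r addr0.
Qed.

Let l1_update (u v : 'rV[int]_n) j : (forall l, l != j -> u 0%R l = v 0%R l) ->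
  l1 u + absz (v 0%R j) = l1 v + absz (u 0%R j).
Proof.
move=> uv; rewrite /l1 (bigD1 j) //= [in RHS](bigD1 j) //=.
rewrite (eq_bigr (fun k => absz (v 0%R k))) => [|k kj]; last by rewrite uv.
lia.
Qed.

(* The Euclidean algorithm on row m, once the rows below are those of the
   identity. Entries to the right of the diagonal are cleared by adding lower
   rows. Among the other columns, the larger of two nonzero entries is reduced
   by the smaller one. In the end a single entry is left, which is 1 or -1
   because the determinant is a multiple of it. *)
Let descent (k : nat) : k < n -> (forall A, fixed k A -> S A) ->
  forall A, fixed k.+1 A -> S A.
Proof.
move=> kn IHk A; pose m : 'I_n := Ordinal kn.
have [N] := ubnP (l1 (row m (SL_mx A))); elim: N A => // N IH A lN fA.
set v := row m (SL_mx A) in lN.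
have vE i : v 0%R i = SL_mx A m i by rewrite mxE.
have [j /andP[mj vj]|above] := pickP (fun j : 'I_n => (m < j) && (v 0%R j != 0%R)).
  have /andP[mj' jm'] := ord_neq mj.
  apply: (@S_mull _ (0 < v 0 j)%R m j) => //; apply: IH; last exact: fixed_mull.
  have fj : row j (SL_mx A) = delta_mx 0%R j by apply: fA.
  have u l : row m (SL_mx (E (0 < v 0 j)%R m j * A)) 0%R l
             = (v 0 l + negif (0 < v 0 j) 1 *+ (l == j))%R.
    by rewrite row_mull // eqxx fj mulr1n !mxE eqxx /=; case: (l == j); rewrite ?mulr1 ?mulr0.
  have := @l1_update (row m (SL_mx (E (0 < v 0 j)%R m j * A))) v j.
  rewrite u eqxx mulr1n => H.
  have /H {H} : forall l, l != j -> row m (SL_mx (E (0 < v 0 j)%R m j * A)) 0%R l = v 0%R l.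
    by move=> l /negPf lj; rewrite u lj mulr0n addr0.
  move: lN vj; rewrite /negif; move: (l1 v) (l1 _) (v 0%R j) => p q r.
  by case: ifP; lia.
pose c (i : 'I_n) := (i <= m) && (v 0%R i != 0%R).
have [[i j] /= /and3P[/andP[im vi] /andP[jm vj] /andP[ij le]]|one] :=
    pickP (fun ij : 'I_n * 'I_n => [&& c ij.1, c ij.2, ij.1 != ij.2
                                   & absz (v 0%R ij.1) <= absz (v 0%R ij.2)]).
  pose e := ((0 < v 0 i) == (0 < v 0 j))%R.
  apply: (@S_mulr _ e i j) => //; apply: IH; last exact: fixed_mulr.
  rewrite row_mulr // -/v; have := l1_elem v e i j.
  move: lN vi vj le; rewrite /e /negif; move: (l1 v) (l1 _) (v 0%R j) (v 0%R i) => p q r s.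
  by case: ifP; lia.
have [i vi] := SL_row_nonzero A m; rewrite -vE in vi.
have im : i <= m by apply: contraFT (above i); rewrite -ltnNge vi andbT.
have v0 j : j != i -> v 0%R j = 0%R.
  move=> ji; apply/eqP; apply: contraFT (above j) => vj; rewrite vj andbT ltnNge.
  apply/negP => jm; have := one (i, j); have := one (j, i).
  by rewrite /= /c im jm vi vj ji eq_sym ji /= leqNgt; lia.
have {vi v0} [r [r1 v0]] : exists r : int, absz r = 1%N /\
    (forall j, v 0%R j = if j == i then r else 0%R).
  exists (v 0%R i); split; last by move=> j; case: eqP => [->|/eqP/v0].
  by rewrite vE; apply: SL_row_unit => j /v0; rewrite vE.
have done B : fixed k.+1 B -> row m (SL_mx B) = delta_mx 0%R m -> S B.
  move=> fB mB; apply: IHk => l; rewrite leq_eqVlt => /predU1P[kl|]; last exact: fB.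
  by have -> : l = m by apply: val_inj.
(* Off the diagonal, the entry is used to create a 1 on the diagonal, which then
   clears it. *)
have [mi|mi] := eqVneq i m; last first.
  pose e := (r < 0)%R.
  have mi' : m != i by rewrite eq_sym.
  apply: (@S_mulr _ e i m) => //; apply: (@S_mulr _ (0 < r)%R m i) => //.
  apply: done; first by apply: fixed_mulr => //; apply: fixed_mulr.
  rewrite !row_mulr // -/v; apply/rowP => p.
  rewrite !mul_elemE !v0 !mxE !eqxx ?(negPf mi) ?(negPf mi').
  have [->|pi] := eqVneq p i; rewrite ?(negPf mi) ?(negPf mi') /e /negif /=.
    by move: r1; clear; do 2?case: ifP; lia.
  by have [_|//] := eqVneq p m; move: r1; clear; case: ifP; lia.
(* In the first row the determinant forces the entry to be 1. In another row an
   entry -1 is turned into 1 with the help of column 0. *)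
subst i; have [k0|k_gt0] := posnP k.
  apply: done => //; apply/rowP => p; rewrite -/v v0 !mxE eqxx /=.
  have [_|//] := eqVneq p m.
  have entry l : l != m -> forall q, SL_mx A l q = (q == l)%:R%R.
    move=> lm q; have : k.+1 <= l by rewrite k0 lt0n; move: lm; rewrite -(inj_eq val_inj) /= k0.
    by move=> /fA /rowP /(_ q); rewrite !mxE eqxx.
  have := SL_det A; rewrite det_trig; last first.
    apply/is_trig_mxP => l q lq; have [_ /negPf ql] := andP (ord_neq lq).
    have [lm|lm] := eqVneq l m; last by rewrite entry // ql.
    by rewrite lm -vE v0 -lm ql.
  rewrite (bigD1 m) //= -vE v0 eqxx big1 ?mulr1 => [/eqP//|l lm].
  by rewrite entry // eqxx.
pose o : 'I_n := Ordinal (leq_trans k_gt0 (ltnW kn)).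
have om : o < m by [].
have /andP[om' mo] := ord_neq om.
have [E1|v1] := eqVneq r 1%R.
  by apply: done => //; apply/rowP => p; rewrite -/v v0 E1 !mxE eqxx; case: (p == m).
have {v1} vm1 : r = (-1)%R by move: r1 v1; clear; lia.
apply: (@S_mulr _ true m o) => //; apply: (@S_mulr _ false o m) => //.
apply: (@S_mulr _ false o m) => //; apply: (@S_mulr _ true m o) => //.
apply: done; first by do ?[apply: fixed_mulr => //].
rewrite !row_mulr // -/v; apply/rowP => p.
rewrite !mul_elemE !v0 vm1 !mxE !eqxx ?(negPf om') ?(negPf mo).
have [->|po] := eqVneq p o; rewrite ?(negPf om') ?(negPf mo) //=.
by have [_|//] := eqVneq p m.
Qed.

Lemma SL_generated A : S A.
Proof.
suff H (k : nat) : k <= n -> forall A, fixed k A -> S A.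
  by apply: (H n) => // l; rewrite leqNgt ltn_ord.
elim: k => [_ {}A fA|k IH kn]; last by apply: descent => //; apply: IH; apply: ltnW.
have -> : A = 1; last exact: S1.
apply: SL_eq; apply/row_matrixP => l; rewrite fA // rowE mulmx1 //.
Qed.
End Generation.

(** * The centre and the presentations of PSL_n(Z) *)
Section Center.
Variable n : nat.
Hypothesis n_gt2 : 2 < n.

(** Commuting with all elementary matrices forces a scalar matrix, whose n-th
    power is the determinant 1. *)
Lemma center_scalar (Z : SL n) : center (SL n) Z ->
  SL_mx Z = 1%:M%R \/ SL_mx Z = (-1)%:M%R.
Proof.
move=> cZ; pose o : 'I_n := Ordinal (ltnW (ltnW n_gt2)).
have rowZ (i j : 'I_n) : i != j -> row j (SL_mx Z) = (SL_mx Z i i *: delta_mx 0 j)%R.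
  move=> ij; pose X := tau n (a_SL n) (b_SL n) i.+1 j.+1.
  have : row i (SL_mx (Z * X)) = row i (SL_mx (X * Z)) by rewrite (cZ X).
  rewrite !SL_mxM SL_tau_elem // row_elem_mul row_mul eqxx mulr1n scale1r => E.
  apply/rowP => p; move/rowP/(_ p): E; rewrite mul_elemE !mxE eqxx /=.
  by case: (p == j) => /=; rewrite ?mulr1 ?mulr0; lia.
have diagZ (j : 'I_n) : SL_mx Z j j = SL_mx Z o o.
  have [->//|jo] := eqVneq j o; rewrite eq_sym in jo.
  by have /rowP/(_ j) := rowZ o j jo; rewrite !mxE !eqxx mulr1.
have [z ZE] : exists z : int, SL_mx Z = z%:M%R.
  exists (SL_mx Z o o); apply/row_matrixP => j.
  have [i /andP[ij _]] := exists_third_index n_gt2 j j.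
  rewrite (rowZ i j ij) diagZ; apply/rowP => p; rewrite !mxE eqxx /= eq_sym.
  by case: (j == p); rewrite ?mulr1 ?mulr0.
have := SL_det Z; rewrite ZE det_scalar => /eqP /(congr1 absz); rewrite abszX => d1.
have z1 : absz z = 1%N.
  by apply/eqP; rewrite -(eqn_exp2r _ _ (ltnW (ltnW n_gt2))) exp1n d1.
have [->|->] : (z = 1 \/ z = -1)%R by move: z1; clear; lia.
  by left.
by right.
Qed.

Lemma center_trivial (Z : SL n) : odd n -> center (SL n) Z -> Z = 1.
Proof.
move=> on /center_scalar [] E; apply: SL_eq; rewrite E //.
by have := SL_det Z; rewrite E det_scalar -signr_odd on.
Qed.
End Center.

Lemma inj_surj_bijective (T U : Type) (f : T -> U) :
  injective f -> (forall y, exists x, f x = y) -> bijective f.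
Proof.
move=> fI fS; exists (fun y => projT1 (cid (fS y))) => [x|y].
  by apply: fI; case: cid.
by case: cid.
Qed.

Lemma PSL_projM (n : nat) : {morph @PSL_proj n : x y / x * y}.
Proof. by move=> x y; rewrite /PSL_proj gmulfM. Qed.

Section Final.
Variable n : nat.
Hypothesis n_gt2 : 2 < n.

Lemma eval_SL_surj (A : SL n) : exists u, eval_SL n u = A.
Proof.
apply: (@SL_generated n n_gt2 (fun A => exists u, eval_SL n u = A)).
- by exists 1; rewrite gmulf1.
- by move=> _ _ [u <-] [v <-]; exists (u * v); rewrite gmulfM.
- by move=> _ [u <-]; exists u^-1; rewrite gmulfV.
move=> {}A i j ij E; exists (tau n word_a word_b i.+1 j.+1).
rewrite tau_morph /= eval_SL_a eval_SL_b; apply: SL_eq; rewrite E SL_tau_elem //.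
Qed.

Lemma presents_PSL_of_kernel (R : set (free_group bool * free_group bool)) :
  (forall r, R r -> PSL_proj (eval_SL n r.1) = PSL_proj (eval_SL n r.2)) ->
  (forall u, center (SL n) (eval_SL n u) -> normal_closure (relators R) u) ->
  exists phi : presented R -> PSL n, presents_PSL phi.
Proof.
move=> R1 R2; pose f u := PSL_proj (eval_SL n (repr (u : presented R))).
have fq u : f (quot_map _ u) = PSL_proj (eval_SL n u).
  have /quot_mapP : quot_map (normal_closure (relators R)) u
      = quot_map _ (repr (quot_map (normal_closure (relators R)) u)).
    by symmetry; apply: reprK.
  move=> /(normal_closure_morph (f := quot_map (center (SL n)) \o eval_SL n) R1) /=.
  by move=> /quot_map_eq1 h; symmetry; apply/quot_mapP; rewrite -gmulfV -gmulfM.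
exists f; split.
- split.
  + move=> u v; have [u' <-] := quot_map_surj u; have [v' <-] := quot_map_surj v.
    rewrite -gmulfM !fq gmulfM; exact: PSL_projM.
  + apply: inj_surj_bijective => [u v|y].
      have [u' <-] := quot_map_surj u; have [v' <-] := quot_map_surj v.
      rewrite !fq => /quot_mapP h; apply/quot_mapP; apply: R2.
      by rewrite gmulfM gmulfV.
    have [A <-] := quot_map_surj y; have [u <-] := eval_SL_surj A.
    by exists (quot_map _ u); rewrite fq.
- by rewrite fq eval_SL_a.
- by rewrite fq eval_SL_b.
Qed.
End Final.

Local Open Scope classical_set_scope.

Theorem theorem5p4 (n : nat) :
  ((3 <= n)%N -> odd n ->
     group_isomorphism (@PSL_proj n) /\
     exists phi : presented (Rn n) -> PSL n, presents_PSL phi) /\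
  ((4 <= n)%N -> ~~ odd n ->
     exists phi : presented (Rn n `|` [set (word_a ^+ n, 1)%g]) -> PSL n,
       presents_PSL phi).
Proof.
split=> [n_gt2 n_odd|n_gt3 n_even].
  split.
    split; first exact: PSL_projM.
    apply: inj_surj_bijective => [x y /quot_mapP h|]; last exact: quot_map_surj.
    by have /mulg1_eq := center_trivial n_gt2 n_odd h; rewrite invgK.
  apply: presents_PSL_of_kernel => // [r Rr|u].
    by rewrite (eval_SL_relations n_gt2 Rr).
  by move=> /(center_trivial n_gt2 n_odd) /(eval_SL_kernel n_gt2).
have n_gt2 : 2 < n by apply: ltnW.
have evan : eval_SL n (word_a ^+ n) = a_SL n ^+ n by rewrite -eval_SL_a; apply: gmulfXn.
have an : SL_mx (a_SL n ^+ n) = (-1)%:M%R.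
  rewrite (a_pow_n n_gt2) -signr_odd; have -> : odd n.-1 by move: n_even n_gt3; lia.
  by [].
have sub u : normal_closure (relators (Rn n)) u ->
    normal_closure (relators (Rn n `|` [set (word_a ^+ n, 1)%g])) u.
  by apply: normal_closureW => _ [r Rr <-]; exists r => //; left.
apply: presents_PSL_of_kernel => // [r [Rr|->]|u].
- by rewrite (eval_SL_relations n_gt2 Rr).
- rewrite /= evan gmulf1; apply/esym/quot_mapP; rewrite invg1 mul1g => Z.
  by apply: SL_eq; rewrite !SL_mxM an mul_scalar_mx mul_mx_scalar.
- (* If u maps to -1 then u a^-n maps to 1. *)
  move=> /(center_scalar n_gt2) [] E.
    by apply: sub; apply: (eval_SL_kernel n_gt2); apply: SL_eq; rewrite E.
  pose N := normal_closure (relators (Rn n `|` [set (word_a ^+ n, 1)%g])).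
  have Na : N (word_a ^+ n).
    apply: normal_closure_sub.
    by exists (word_a ^+ n, 1); [right | rewrite /= divg1].
  have [N1 NF _] := normal_setP N.
  suff Nu : N (u / word_a ^+ n) by have := NF _ _ Nu (NF _ _ N1 Na); rewrite div1g invgK mulgVK.
  apply: sub; apply: (eval_SL_kernel n_gt2).
  have -> : eval_SL n (u / word_a ^+ n) = eval_SL n u / eval_SL n (word_a ^+ n) by apply: gmulfF.
  rewrite evan.
  have -> : eval_SL n u = a_SL n ^+ n by apply: SL_eq; rewrite an E.
  exact: mulgV.
Qed.
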